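(* Assume that $V_1$ has the normal distribution $\mathcal{N}(0,\sigma^2)$ with $\sigma^2>0$, and that there exists $t>0$ such that $\mathbb{E}[\exp(t\varepsilon_0^2)]<\infty$ and $\mathbb{E}[\exp(tX_0^2)]<\infty$. Then the sequence $$\left(\frac{\sqrt n}{b_n}\big(\widehat D_n-D^*\big)\right)_{n\ge1}$$ satisfies a large deviation principle on $\mathbb{R}$ with speed $b_n^2$ and good rate function $I_D(x)=\dfrac{x^2}{2\sigma_D^2}$, where $D^*=2(1-\rho^* )$ and $\sigma_D^2=4\sigma_\rho^2$.
   Context: Model: for all $n\ge1$, $X_n=\theta X_{n-1}+\varepsilon_n$ and $\varepsilon_n=\rho\,\varepsilon_{n-1}+V_n$, where $\theta,\rho$ are real parameters with $|\theta|<1$, $|\rho|<1$, $(V_n)_{n\ge1}$ is a sequence of i.i.d. real random variables with zero mean and positive variance $\sigma^2$, and the square-integrable real initial values $X_0,\varepsilon_0$ are arbitrary. Statistics: $\widehat\theta_n=\dfrac{\sum_{k=1}^n X_kX_{k-1}}{\sum_{k=1}^n X_{k-1}^2}$; for fixed $n$, the residuals are $\widehat\varepsilon_k=X_k-\widehat\theta_nX_{k-1}$ for $1\le k\le n$ and $\widehat\varepsilon_0=X_0$; the Durbin-Watson statistic is $\widehat D_n=\dfrac{\sum_{k=1}^n(\widehat\varepsilon_k-\widehat\varepsilon_{k-1})^2}{\sum_{k=0}^n\widehat\varepsilon_k^{\,2}}$. Constants: $\theta^*=\frac{\theta+\rho}{1+\theta\rho}$, $\rho^*=\theta\rho\,\theta^*$,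 $\sigma_\rho^2=\frac{1-\theta\rho}{(1+\theta\rho)^3}\big((\theta+\rho)^2(1+\theta\rho)^2+(\theta\rho)^2(1-\theta^2)(1-\rho^2)\big)$. In the degenerate case $\theta=\rho=0$, where $\sigma_D^2=0$, the expression $x^2/(2\sigma_D^2)$ is read as $0$ for $x=0$ and $+\infty$ for $x\neq0$. $(b_n)$ is an increasing sequence of positive numbers with $b_n\to\infty$ and $b_n/\sqrt n\to0$. A sequence $(Z_n)$ satisfies a large deviation principle with speed $b_n^2$ and good rate function $I$ if $I$ is lower semicontinuous with values in $[0,\infty]$ and compact level sets, and for every Borel set $B$, $-\inf_{B^\circ}I\le\liminf_n b_n^{-2}\log\mathbb{P}(Z_n\in B)\le\limsup_n b_n^{-2}\log\mathbb{P}(Z_n\in B)\le-\inf_{\overline B}I$. *)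

(* Defs.v *)
From HB Require Import structures.
From mathcomp Require Import all_boot all_order all_algebra.
From mathcomp Require Import all_classical all_reals all_analysis.
From mathcomp Require Import measurable_realfun.

Set Implicit Arguments.
Unset Strict Implicit.
Unset Printing Implicit Defensive.

Import Order.TTheory GRing.Theory Num.Theory.
Import numFieldNormedType.Exports.

Local Open Scope classical_set_scope.
Local Open Scope ring_scope.

Section random_sequences.
Context {d : measure_display} {T : measurableType d} {R : realType}.
Variable P : probability T R.

Definition mutually_independent (Y : nat -> {RV P >-> R}) :=
  forall (J : seq nat) (B : nat -> set R), uniq J ->
    (forall j, measurable (B j)) ->
    (P (\bigcap_(j in [set` J]) (Y j @^-1` B j)) =
       \prod_(j <- J) P (Y j @^-1` B j))%E.

Definition identically_distributed (Y : nat -> {RV P >-> R}) :=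
  forall (m n : nat) (B : set R), measurable B ->
    distribution P (Y m) B = distribution P (Y n) B.

(* [normal_prob] takes the standard deviation, not the variance. *)
Definition has_normal_law (Y : {RV P >-> R}) (m sigma : R) :=
  forall B : set R, measurable B ->
    distribution P Y B = normal_prob m sigma B.

(* The noise (V_n) is indexed by n >= 1: [V 0] is unconstrained.  No
   independence between (X_0, eps_0) and (V_n) is required. *)
Record autoregressive_model (theta rho sigma : R)
    (X eps V : nat -> {RV P >-> R}) : Prop := {
  stable_theta : `|theta| < 1 ;
  stable_rho : `|rho| < 1 ;
  sigma_gt0 : 0 < sigma ;
  noise_independent : mutually_independent (fun n => V n.+1) ;
  noise_identically_distributed :
    identically_distributed (fun n => V n.+1) ;
  noise_mean : ('E_P[V 1%N] = 0)%E ;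
  noise_variance : ('V_P[V 1%N] = (sigma ^+ 2)%:E)%E ;
  X0_square_integrable : ('E_P[(fun w => X 0%N w ^+ 2)%R] < +oo)%E ;
  eps0_square_integrable : ('E_P[(fun w => eps 0%N w ^+ 2)%R] < +oo)%E ;
  X_recursion : forall n w, X n.+1 w = theta * X n w + eps n.+1 w ;
  eps_recursion : forall n w, eps n.+1 w = rho * eps n w + V n.+1 w }.

End random_sequences.

(* The statistics are defined pathwise, on a real sequence x; a quotient with
   a zero denominator has value 0. *)
Section durbin_watson.
Context {R : realType}.
Implicit Type x : nat -> R.

Definition theta_hat x (n : nat) : R :=
  (\sum_(1 <= k < n.+1) x k * x k.-1) / (\sum_(1 <= k < n.+1) x k.-1 ^+ 2).

Definition residual x (n k : nat) : R :=
  if k is k'.+1 then x k'.+1 - theta_hat x n * x k' else x 0%N.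

Definition durbin_watson x (n : nat) : R :=
  (\sum_(1 <= k < n.+1) (residual x n k - residual x n k.-1) ^+ 2) /
  (\sum_(0 <= k < n.+1) residual x n k ^+ 2).

Definition theta_star (theta rho : R) : R :=
  (theta + rho) / (1 + theta * rho).

Definition rho_star (theta rho : R) : R :=
  theta * rho * theta_star theta rho.

Definition D_star (theta rho : R) : R := 2 * (1 - rho_star theta rho).

Definition sigma2_rho (theta rho : R) : R :=
  (1 - theta * rho) / (1 + theta * rho) ^+ 3 *
  ((theta + rho) ^+ 2 * (1 + theta * rho) ^+ 2 +
   (theta * rho) ^+ 2 * (1 - theta ^+ 2) * (1 - rho ^+ 2)).

Definition sigma2_D (theta rho : R) : R := 4 * sigma2_rho theta rho.

(* x^2 / (2 v), read as 0 at x = 0 and +oo elsewhere when v = 0. *)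
Definition quadratic_rate (v x : R) : \bar R :=
  if v == 0 then (if x == 0 then 0%E else +oo%E)
  else (x ^+ 2 / (2 * v))%:E.

End durbin_watson.

Section durbin_watson_variable.
Context {d : measure_display} {T : measurableType d} {R : realType}.
Variable P : probability T R.

Definition scaled_durbin_watson (theta rho : R) (b : nat -> R)
    (X : nat -> {RV P >-> R}) (n : nat) : T -> R :=
  fun w => Num.sqrt n%:R / b n *
           (durbin_watson (fun k => X k w) n - D_star theta rho).

Lemma measurable_invr : measurable_fun [set: R] (@GRing.inv R).
Proof.
have -> : [set: R] = [set 0] `|` ~` [set 0] by rewrite setUv.
apply/measurable_funU => //; first exact: measurableC.
split; first exact: measurable_fun_set1.
apply: open_continuous_measurable_fun => [|x /set_mem /= /eqP x0].
  by apply: closed_openC; exact: closed_eq.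
exact: inv_continuous.
Qed.

Lemma measurable_ratio (f g : T -> R) : measurable_fun setT f ->
  measurable_fun setT g -> measurable_fun setT (fun w => f w / g w).
Proof.
move=> mf mg; apply: measurable_funM => //.
exact: (measurableT_comp measurable_invr).
Qed.

Lemma measurable_theta_hat (X : nat -> {RV P >-> R}) n :
  measurable_fun setT (fun w => theta_hat (fun k => X k w) n).
Proof.
apply: measurable_ratio; apply: measurable_sum => k.
  exact: measurable_funM.
exact: measurable_funX.
Qed.

Lemma measurable_residual (X : nat -> {RV P >-> R}) n k :
  measurable_fun setT (fun w => residual (fun j => X j w) n k).
Proof.
case: k => [|k] /=; first exact: measurable_funPT.
apply: measurable_funB => //; apply: measurable_funM => //.
exact: measurable_theta_hat.
Qed.

Lemma measurable_scaled_durbin_watson theta rho b X n :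
  measurable_fun setT (scaled_durbin_watson theta rho b X n).
Proof.
apply: measurable_funM => //; apply: measurable_funB => //.
apply: measurable_ratio; apply: measurable_sum => k; apply: measurable_funX.
  by apply: measurable_funB; exact: measurable_residual.
exact: measurable_residual.
Qed.

HB.instance Definition _ theta rho b X n :=
  isMeasurableFun.Build _ _ _ _ (scaled_durbin_watson theta rho b X n)
    (measurable_scaled_durbin_watson theta rho b X n).

End durbin_watson_variable.

Section large_deviations.
Context {R : realType}.
Local Open Scope ereal_scope.

Definition good_rate_function (I : R -> \bar R) :=
  [/\ forall x, 0 <= I x,
      lower_semicontinuous I &
      forall a : R, compact [set x | I x <= a%:E]].

(* [lne 0 = -oo] and [ereal_inf set0 = +oo]. *)
Definition large_deviation_principle {d : measure_display}
    {T : measurableType d} (P : probability T R)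
    (Z : nat -> {RV P >-> R}) (speed : nat -> R) (I : R -> \bar R) :=
  good_rate_function I /\
  forall B : set R, measurable B ->
    [/\ - ereal_inf (I @` B°) <=
          limn_einf (fun n => (speed n)^-1%:E * lne (P (Z n @^-1` B))),
        limn_einf (fun n => (speed n)^-1%:E * lne (P (Z n @^-1` B))) <=
          limn_esup (fun n => (speed n)^-1%:E * lne (P (Z n @^-1` B))) &
        limn_esup (fun n => (speed n)^-1%:E * lne (P (Z n @^-1` B))) <=
          - ereal_inf (I @` closure B)].

End large_deviations.

(* Main.v *)
(** Put a = theta + rho and c = - theta rho, so that
    X_(k+2) = a X_(k+1) + c X_k + V_(k+2).  The Yule-Walker equations express
    the sums of X_k^2, X_k X_(k+1) and X_k X_(k+2), up to boundary terms, through
    M = sum V_(k+2) X_(k+1), N = sum V_(k+2) X_k and sum V_(k+2)^2, and an exact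
    expansion of the Durbin-Watson statistic then gives
    D_n - D^* = (c1 M + c2 N) / n + remainder.  A sequence is negligible when it
    exceeds each threshold with probability smaller than every exp (- K b_n^2),
    and tight when for each K a threshold achieves exp (- K b_n^2); negligible
    sequences form an ideal in the ring of tight ones, so after multiplication
    by sqrt n / b_n the remainder is negligible.  The initial values, possibly
    dependent on the noise, contribute only negligible terms, so X may be
    replaced in M and N by the process started from zero, which is predictable.

    For a linear form Y of that process, exp (s sum V Y - s^2 sigma^2 / 2 sum Y^2)
    has expectation 1 by successive Gaussian integrations, while
    sum Y^2 / n converges up to a negligible error, again by Yule-Walker.
    Exponential tilting by this martingale yields both deviation bounds for
    sum V Y / (b_n sqrt n), with the Gaussian rate. *)

Require Import Defs.
From HB Require Import structures.
From mathcomp Require Import all_boot all_order all_algebra.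
From mathcomp Require Import all_classical all_reals all_analysis.
From mathcomp Require Import measurable_realfun ring lra.
Import Order.TTheory GRing.Theory Num.Theory.
Import numFieldNormedType.Exports.
Local Open Scope classical_set_scope.
Local Open Scope ring_scope.

Set Implicit Arguments.
Unset Strict Implicit.
Unset Printing Implicit Defensive.

(** * Second-order autoregressions on real sequences *)

(** Since b_n / sqrt n -> 0, b_n^2 is of smaller order than b_n sqrt n, so a probability exp (- c
    b_n sqrt n) beats every exp (- K b_n^2). Exponential moments of the squared initial values and
    of the squared noise therefore suffice to discard all boundary terms.

    The fluctuations of sum X_k^2 are controlled at the same scale as M and N, by tightness only;
    they leave the statistic because Yule-Walker turns (1 - c) (theta_hat - theta_star) sum X_k^2
    into M plus a boundary term, after which the expansion is exact.

    A loop has to be broken: the Gaussian bounds need the limit of sum Y^2 / n, and this limit needs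
    M and N to be tight. Tightness is obtained beforehand, from a crude pathwise bound of sum Y^2 by
    the noise energy. The same bound serves in the lower bound: where sum Y^2 / n is far from its
    limit the tilt is unbounded, so the rarity of this event must be combined with exponential
    moments.

    When theta = rho = 0 the coefficients c1 and c2 vanish, and the martingale is identically
    zero. *)

Section stable_recursions.
Context (R : realType).
Implicit Types (a K : R) (y z u r : nat -> R).

Fixpoint ar a z n : R := if n is m.+1 then a * ar a z m + z m.+1 else 0.

Lemma ar_bound a y z K N : `|a| < 1 -> (forall k, y k.+1 = a * y k + z k.+1) ->
  0 <= K -> (forall k, (k < N)%N -> `|z k.+1| <= K) ->
  forall k, (k <= N)%N -> `|y k| <= `|y 0%N| + K / (1 - `|a|).
Proof.
move=> a1 yE K0 zK; have a0 : 0 < 1 - `|a| by rewrite subr_gt0.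
elim=> [|k IH] kN; first by rewrite lerDl divr_ge0// ltW.
rewrite yE (le_trans (ler_normD _ _))// normrM.
have h : `|a| * `|y k| <= `|a| * (`|y 0%N| + K / (1 - `|a|)).
  by rewrite ler_wpM2l// IH// ltnW.
rewrite (le_trans (lerD h (zK _ kN)))// mulrDr -addrA lerD//.
  by rewrite ler_piMl// ltW.
set L := K / _; have -> : K = L * (1 - `|a|) by rewrite divfK// gt_eqF.
by rewrite mulrC -mulrDr addrC subrK mulr1.
Qed.

Lemma sum_shift (f : nat -> R) n :
  \sum_(k < n) f k.+1 = \sum_(k < n) f k + f n - f 0%N.
Proof.
have <- : \sum_(k < n.+1) f k = \sum_(k < n) f k + f n by rewrite big_ord_recr.
by rewrite big_ord_recl/= [RHS]addrC addKr.
Qed.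

Lemma sum_split_first (f : nat -> R) n : (0 < n)%N ->
  \sum_(k < n) f k = f 0%N + \sum_(k < n.-1) f k.+1.
Proof. by case: n => // n _; rewrite big_ord_recl. Qed.

Lemma sum_drop_last (f : nat -> R) n : (0 < n)%N ->
  \sum_(k < n) f k - f n.-1 = \sum_(k < n.-1) f k.
Proof. by case: n => // n _; rewrite big_ord_recr/= addrK. Qed.

(** Summing the recursion reproduces the same sum shifted by one index; the leftover [u n] is
    nonnegative and is dropped. *)
Lemma sum_stable a u r n : (forall k, 0 <= u k) ->
  (forall k, u k.+1 <= a * u k + r k.+1) ->
  (1 - a) * \sum_(k < n) u k <= u 0%N + \sum_(k < n) r k.+1.
Proof.
move=> u0 ur.
have h : \sum_(k < n) u k.+1 <= a * \sum_(k < n) u k + \sum_(k < n) r k.+1.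
  by rewrite mulr_sumr -big_split/=; apply: ler_sum => k _.
by rewrite sum_shift in h; have := u0 n; lra.
Qed.

Lemma sum_norm_stable a y z n : `|a| < 1 -> (forall k, y k.+1 = a * y k + z k.+1) ->
  \sum_(k < n) `|y k| <= (`|y 0%N| + \sum_(k < n) `|z k.+1|) / (1 - `|a|).
Proof.
move=> a1 yE; rewrite ler_pdivlMr ?subr_gt0// mulrC.
apply: (@sum_stable `|a| (fun k => `|y k|) (fun k => `|z k|)) => // k.
by rewrite yE (le_trans (ler_normD _ _))// normrM.
Qed.

(** Convexity of the square, with weights [|a|] and [1 - |a|] at the points y1 (up to sign) and z1 /
    (1 - |a|). The factor of [y1 ^+ 2] stays below 1, whereas the bound 2 a^2 might not. *)
Lemma sqr_affine_le a (y1 z1 : R) : `|a| < 1 ->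
  (a * y1 + z1) ^+ 2 <= `|a| * y1 ^+ 2 + z1 ^+ 2 / (1 - `|a|).
Proof.
move=> a1; have a0 : 0 < 1 - `|a| by rewrite subr_gt0.
rewrite -subr_ge0.
have [s0|s0] := leP 0 a.
  rewrite (ger0_norm s0) in a0 *.
  have -> : a * y1 ^+ 2 + z1 ^+ 2 / (1 - a) - (a * y1 + z1) ^+ 2 =
      a * ((1 - a) * y1 - z1) ^+ 2 / (1 - a) by field; rewrite gt_eqF.
  by apply: divr_ge0; [apply: mulr_ge0 => //; exact: sqr_ge0|exact: ltW].
rewrite (ltr0_norm s0) in a0 *.
have -> : - a * y1 ^+ 2 + z1 ^+ 2 / (1 - - a) - (a * y1 + z1) ^+ 2 =
    - a * ((1 + a) * y1 + z1) ^+ 2 / (1 - - a) by field; rewrite gt_eqF// -[ltRHS]addrC; lra.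
apply: divr_ge0; last exact: ltW.
by apply: mulr_ge0; [lra|exact: sqr_ge0].
Qed.

(** One factor [1 - |a|] comes from the convexity inequality, the other from summing the
    recursion. *)
Lemma sum_sqr_stable a y z n : `|a| < 1 -> (forall k, y k.+1 = a * y k + z k.+1) ->
  y 0%N = 0 ->
  \sum_(k < n) y k ^+ 2 <= (\sum_(k < n) z k.+1 ^+ 2) / (1 - `|a|) ^+ 2.
Proof.
move=> a1 yE y0; have a0 : 0 < 1 - `|a| by rewrite subr_gt0.
have := @sum_stable `|a| (fun k => y k ^+ 2) (fun k => z k ^+ 2 / (1 - `|a|)) n.
rewrite y0 expr0n add0r -mulr_suml => h.
rewrite expr2 invfM mulrA ler_pdivlMr// mulrC; apply: h => // k; first exact: sqr_ge0.
by rewrite yE sqr_affine_le.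
Qed.

End stable_recursions.

Section autoregression.
Context (R : realType).
Variables (theta rho : R).
Hypotheses (theta1 : `|theta| < 1) (rho1 : `|rho| < 1).
Implicit Types (x e v : nat -> R) (K : R).

Let t0 : 0 < 1 - `|theta|. Proof. by rewrite subr_gt0. Qed.
Let r0 : 0 < 1 - `|rho|. Proof. by rewrite subr_gt0. Qed.

(* Started from zero, hence a function of the noise alone: unlike [X], it does
   not involve initial values that may depend on the noise. *)
Definition centered_ar v : nat -> R := ar theta (ar rho v).

(** Sup-norm gain of the two filters in cascade, initial values included. *)
Definition ar_gain : R := 1 + (1 + (1 - `|rho|)^-1) / (1 - `|theta|).

Lemma ar_gain_gt0 : 0 < ar_gain.
Proof. by rewrite ltr_pwDl// divr_ge0 ?(ltW t0)// addr_ge0// invr_ge0 ltW. Qed.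

Lemma autoregression_bound x e v K N :
  (forall k, x k.+1 = theta * x k + e k.+1) ->
  (forall k, e k.+1 = rho * e k + v k.+1) ->
  `|x 0%N| <= K -> `|e 0%N| <= K -> (forall k, (k < N)%N -> `|v k.+1| <= K) ->
  forall k, (k <= N)%N -> `|x k| <= K * ar_gain.
Proof.
move=> xE eE x0 e0 vK k kN.
have K0 : 0 <= K := le_trans (normr_ge0 _) x0.
have eb k' : (k' < N)%N -> `|e k'.+1| <= K + K / (1 - `|rho|).
  move=> kN'; apply: (le_trans (ar_bound rho1 eE K0 vK kN')).
  by rewrite lerD2r.
have Kr0 : 0 <= K + K / (1 - `|rho|) by rewrite addr_ge0// divr_ge0// ltW.
apply: (le_trans (ar_bound theta1 xE Kr0 eb kN)).
rewrite /ar_gain mulrDr mulr1 lerD// mulrA ler_pM2r ?invr_gt0//.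
by rewrite mulrDr mulr1.
Qed.

(** The noise cancels in the difference, which decays geometrically. Its l1 norm is thus bounded
    uniformly in [n], so that a maximum bound on the noise is enough in
    [initial_values_negligible]. *)
Lemma initial_values_effect x e v n :
  (forall k, x k.+1 = theta * x k + e k.+1) ->
  (forall k, e k.+1 = rho * e k + v k.+1) ->
  \sum_(k < n) `|x k - centered_ar v k| <=
  (`|x 0%N| + `|e 0%N| / (1 - `|rho|)) / (1 - `|theta|).
Proof.
move=> xE eE; pose g k := e k - ar rho v k.
have gE k : g k.+1 = rho * g k + (fun=> 0) k.+1 by rewrite /g /= eE; ring.
have hE k : x k.+1 - centered_ar v k.+1 = theta * (x k - centered_ar v k) + g k.+1.
  by rewrite /g /centered_ar /= xE; ring.
have := @sum_norm_stable _ theta (fun k => x k - centered_ar v k) g n theta1 hE.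
move=> /le_trans; apply; rewrite ler_pM2r ?invr_gt0// /= subr0 lerD2l.
(* One extra term is taken so that the sum starting at [g 1] is recovered by dropping the first
   one. *)
have := @sum_norm_stable _ rho g (fun=> 0) n.+1 rho1 gE.
have -> : \sum_(k < n.+1) `|0 : R| = 0 by rewrite big1// => k _; rewrite normr0.
have g0 : g 0%N = e 0%N by rewrite /g /= subr0.
rewrite big_ord_recl/= addr0 g0 => h; apply: le_trans h.
by rewrite lerDr.
Qed.

Lemma sum_sqr_centered_ar v n :
  \sum_(k < n) centered_ar v k ^+ 2 <=
  (\sum_(k < n.+1) v k.+1 ^+ 2) / ((1 - `|rho|) ^+ 2 * (1 - `|theta|) ^+ 2).
Proof.
have h1 := @sum_sqr_stable _ theta (centered_ar v) (ar rho v) n theta1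
  (fun=> erefl) erefl.
have h2 := @sum_sqr_stable _ rho (ar rho v) v n.+1 rho1 (fun=> erefl) erefl.
apply: (le_trans h1).
rewrite [leRHS](_ : _ = (\sum_(k < n.+1) v k.+1 ^+ 2) / (1 - `|rho|) ^+ 2 /
  (1 - `|theta|) ^+ 2); last by rewrite invfM mulrA.
rewrite ler_wpM2r ?invr_ge0 ?sqr_ge0//.
apply: le_trans h2; rewrite [leRHS]big_ord_recl/=.
by rewrite expr0n add0r.
Qed.

Lemma autoregression_order2 x e v :
  (forall k, x k.+1 = theta * x k + e k.+1) ->
  (forall k, e k.+1 = rho * e k + v k.+1) ->
  forall k, x k.+2 = (theta + rho) * x k.+1 + (- (theta * rho)) * x k + v k.+2.
Proof.
move=> xE eE k; rewrite xE eE.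
have -> : e k.+1 = x k.+1 - theta * x k by rewrite xE; ring.
by ring.
Qed.

End autoregression.

Section second_order_autoregression.
Context (R : realType).
Variables (a c : R) (x v : nat -> R) (n : nat).
Hypothesis xE : forall k, x k.+2 = a * x k.+1 + c * x k + v k.+2.

Local Notation S0 := (\sum_(k < n) x k ^+ 2).
Local Notation S1 := (\sum_(k < n) x k.+1 * x k).
Local Notation S2 := (\sum_(k < n) x k.+2 * x k).
Local Notation M := (\sum_(k < n) v k.+2 * x k.+1).
Local Notation N := (\sum_(k < n) v k.+2 * x k).
Local Notation Q := (\sum_(k < n) v k.+2 ^+ 2).

(* [edge1] and [edge2] collect the boundary terms created by shifting the
   summation index in the Yule-Walker equations. *)
Definition edge1 : R := a * (x n * x n - x 0 * x 0) - x n.+1 * x n + x 1 * x 0.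

Definition edge2 : R := a * (x n.+1 * x n - x 1 * x 0) -
  (x n * x n - x 0 * x 0 + (x n.+1 * x n.+1 - x 1 * x 1)).

Lemma sum_sqr_shift1 : \sum_(k < n) x k.+1 ^+ 2 = S0 + x n ^+ 2 - x 0 ^+ 2.
Proof. exact: (sum_shift (fun k => x k ^+ 2)). Qed.

Lemma sum_sqr_shift2 : \sum_(k < n) x k.+2 ^+ 2 =
  S0 + x n ^+ 2 - x 0 ^+ 2 + x n.+1 ^+ 2 - x 1 ^+ 2.
Proof. by rewrite (sum_shift (fun k => x k.+1 ^+ 2)) sum_sqr_shift1. Qed.

Lemma sum_mul_shift1 : \sum_(k < n) x k.+2 * x k.+1 = S1 + x n.+1 * x n - x 1 * x 0.
Proof. exact: (sum_shift (fun k => x k.+1 * x k)). Qed.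

Lemma yule_walker1 : (1 - c) * S1 = a * S0 + M + edge1.
Proof.
have := sum_mul_shift1.
under eq_bigr do rewrite xE mulrDl mulrDl -!mulrA -expr2.
rewrite !big_split/= -!mulr_sumr sum_sqr_shift1.
have -> : \sum_(k < n) x k * x k.+1 = S1 by apply: eq_bigr => k _; rewrite mulrC.
by rewrite /edge1; lra.
Qed.

Lemma yule_walker2 : S2 = a * S1 + c * S0 + N.
Proof.
rewrite 2!mulr_sumr -!big_split/=; apply: eq_bigr => k _.
by rewrite xE; ring.
Qed.

Lemma sum_noise_shift2 : \sum_(k < n) v k.+2 * x k.+2 = a * M + c * N + Q.
Proof.
rewrite 2!mulr_sumr -!big_split/=; apply: eq_bigr => k _.
by rewrite xE; ring.
Qed.

Lemma yule_walker3 : S0 = a * S1 + c * S2 + a * M + c * N + Q + edge2.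
Proof.
have := sum_sqr_shift2.
have -> : \sum_(k < n) x k.+2 ^+ 2 = a * \sum_(k < n) x k.+2 * x k.+1 +
    c * S2 + \sum_(k < n) v k.+2 * x k.+2.
  rewrite 2!mulr_sumr -!big_split/=; apply: eq_bigr => k _.
  by rewrite [in RHS]xE expr2 {1}xE xE; ring.
rewrite sum_mul_shift1 sum_noise_shift2 /edge2; lra.
Qed.

(** Elimination of S1 and S2 from the three Yule-Walker relations. For the stable model the factor
    on the left is (1 - theta rho) (1 - theta^2) (1 - rho^2) > 0, so the equation determines S0. *)
Lemma variance_equation :
  (1 + c) * ((1 - c) ^+ 2 - a ^+ 2) * S0 =
  a * (1 + c) * (M + edge1) + (1 - c) * (a * M + 2 * c * N + Q + edge2).
Proof.
have h1 := yule_walker1; have h2 := yule_walker2; have h3 := yule_walker3.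
move: h1 h2 h3; set s0 := S0; set s1 := S1; set s2 := S2 => h1 h2 h3.
have h4 : (1 - c ^+ 2) * s0 = a * (1 + c) * s1 + a * M + 2 * c * N + Q + edge2.
  have : c * s2 = c * (a * s1 + c * s0 + N) by rewrite h2.
  by lra.
have : (1 - c) * ((1 - c ^+ 2) * s0) = (1 - c) * (a * (1 + c) * s1 + a * M + 2 * c * N + Q + edge2).
  by rewrite h4.
have : a * (1 + c) * ((1 - c) * s1) = a * (1 + c) * (a * s0 + M + edge1) by rewrite h1.
lra.
Qed.

End second_order_autoregression.

(** * Exact expansion of the Durbin-Watson statistic *)

Section durbin_watson_expansion.
Context (R : realType).
Variables (x : nat -> R) (n : nat).
Local Notation S0 := (\sum_(k < n) x k ^+ 2).
Local Notation S1 := (\sum_(k < n) x k.+1 * x k).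
Local Notation S2 := (\sum_(k < n) x k.+2 * x k).
Local Notation t := (theta_hat x n).

Lemma theta_hatE : t = S1 / S0.
Proof. by rewrite /theta_hat !big_add1 !big_mkord. Qed.

(* Also when [S0 = 0], where the quotient is [0]. *)
Lemma theta_hat_mul : t * S0 = S1.
Proof.
rewrite theta_hatE; have [S00|S0n0] := eqVneq S0 0; last by rewrite divfK.
rewrite S00 mulr0 big1// => k _.
have /eqP := S00; rewrite psumr_eq0; last by move=> i _; exact: sqr_ge0.
by move=> /allP/(_ k); rewrite mem_index_enum sqrf_eq0 => /(_ isT)/eqP ->; rewrite mulr0.
Qed.

Definition dw_den : R := \sum_(0 <= k < n.+1) residual x n k ^+ 2.
Definition dw_num : R :=
  \sum_(1 <= k < n.+1) (residual x n k - residual x n k.-1) ^+ 2.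

(** The initial residual [x 0] restores exactly the square lost when the sum of [x k.+1 ^+ 2] is
    shifted, so a single boundary term remains. *)
Lemma dw_denE : dw_den = S0 * (1 - t ^+ 2) + x n * x n.
Proof.
rewrite /dw_den big_mkord big_ord_recl/=.
have -> : \sum_(i < n) (x i.+1 - t * x i) ^+ 2 =
   \sum_(k < n) x k.+1 ^+ 2 - 2 * t * S1 + t ^+ 2 * S0.
  rewrite 2!mulr_sumr -sumrN -!big_split/=; apply: eq_bigr => k _; ring.
rewrite sum_sqr_shift1 -theta_hat_mul; ring.
Qed.

Definition dw_edge : R := x n * x n - x 0 * x 0 - t ^+ 2 * (x n.-1 * x n.-1)
  - 2 * (t * (x n.+1 * x n.-1)) + 2 * (t * (1 + t) * (x n * x n.-1)).

Lemma dw_numE : (0 < n)%N -> dw_num = 2 * S0 * (1 - t ^+ 2) + 2 * t * (S2 - t ^+ 2 * S0) + dw_edge.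
Proof.
move=> n0; pose f k := (x k.+2 - (1 + t) * x k.+1 + t * x k) ^+ 2.
(* The second-order differences stop at k = n - 2; the sum is completed to [n] terms so that all
   sums share one range. The value [x n.+1], foreign to the statistic, enters here. *)
have -> : dw_num = (x 1 - (1 + t) * x 0) ^+ 2 + \sum_(k < n) f k - f n.-1.
  rewrite -addrA (sum_drop_last f n0) /dw_num big_add1 big_mkord.
  rewrite (sum_split_first (fun k => (residual x n k.+1 - residual x n k) ^+ 2) n0) /f/=.
  congr (_ + _); first by congr (_ ^+ 2); ring.
  by apply: eq_bigr => k _; congr (_ ^+ 2); ring.
have -> : \sum_(k < n) f k = \sum_(k < n) x k.+2 ^+ 2 +
   (1 + t) ^+ 2 * \sum_(k < n) x k.+1 ^+ 2 + t ^+ 2 * S0 -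
   2 * (1 + t) * \sum_(k < n) x k.+2 * x k.+1 + 2 * t * S2 - 2 * t * (1 + t) * S1.
  rewrite 5!mulr_sumr -!sumrN -!big_split/=; apply: eq_bigr => k _.
  by rewrite /f; ring.
rewrite sum_sqr_shift1 sum_sqr_shift2 sum_mul_shift1 -theta_hat_mul /dw_edge /f prednK//.
ring.
Qed.

(** The constant 2 (1 + c a / (1 - c)) is [D_star]. With it, the coefficient of S0 vanishes at t = a
    / (1 - c), and Yule-Walker identifies (1 - c) (t - a / (1 - c)) S0 with [M]; hence S0 disappears
    and only functions of t multiply [M] and [N]. *)
Lemma dw_expansion (a c : R) (v : nat -> R) : (0 < n)%N -> 1 - c != 0 ->
  (forall k, x k.+2 = a * x k.+1 + c * x k + v k.+2) ->
  let M := \sum_(k < n) v k.+2 * x k.+1 + edge1 a x n in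
  let N := \sum_(k < n) v k.+2 * x k in
  dw_num - 2 * (1 + c * (a / (1 - c))) * dw_den =
  2 * (c / (1 - c) * (1 - t ^+ 2) * M + t * (N - t * M)) +
  (dw_edge - 2 * (1 + c * (a / (1 - c))) * (x n * x n)).
Proof.
move=> n0 c1 xE M N; rewrite dw_numE// dw_denE (yule_walker2 n xE) -/N.
have : M = (1 - c) * (t * S0) - a * S0.
  by rewrite theta_hat_mul (yule_walker1 n xE) /M; ring.
rewrite -theta_hat_mul => ->; field; exact: c1.
Qed.

End durbin_watson_expansion.

(** * Gaussian integration against independent noise *)

Section density.
Context d (T : measurableType d) (R : realType).
Variables (mu nu : {measure set T -> \bar R}) (h : T -> R).
Hypothesis mh : measurable_fun setT h.
Hypothesis h0 : forall x, 0 <= h x.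
Hypothesis nuE : forall A, measurable A -> nu A = (\int[mu]_(x in A) (h x)%:E)%E.
Import HBNNSimple.

Let integral_density_nnsfun (f : {nnsfun T >-> R}) :
  (\int[nu]_x (f x)%:E = \int[mu]_x ((f x)%:E * (h x)%:E))%E.
Proof.
under [LHS]eq_integral do rewrite fimfunE -fsumEFin//.
rewrite ge0_integral_fsum//; last 2 first.
  - by move=> r; exact/measurable_EFinP/measurableT_comp.
  - by move=> n x _; rewrite EFinM nnfun_muleindic_ge0.
under [RHS]eq_integral.
  move=> x _; rewrite fimfunE -fsumEFin// ge0_mule_fsuml; last first.
    by move=> r; rewrite EFinM nnfun_muleindic_ge0.
  over.
have mmh : measurable_fun setT (fun x => (h x)%:E) by exact/measurable_EFinP.
rewrite [RHS]ge0_integral_fsum//; last 2 first.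
  - move=> r; apply: emeasurable_funM => //.
    by apply/measurable_EFinP; exact/measurableT_comp.
  - by move=> r x _; rewrite mule_ge0 ?lee_fin// -lee_fin EFinM nnfun_muleindic_ge0.
apply: eq_fsbigr => r rf.
have mr : measurable (f @^-1` [set r]) by exact: measurable_sfunP.
rewrite integralZl_indic_nnsfun// integral_indic// setIT nuE//.
have r0 : 0 <= r by move: rf; rewrite inE => -[x _ <-].
under [RHS]eq_integral do rewrite EFinM -muleA.
rewrite ge0_integralZl//; last 2 first.
  - by apply: emeasurable_funM => //; exact/measurable_EFinP/measurable_indic.
  - by move=> x _; rewrite mule_ge0 ?lee_fin.
congr (_ * _)%E; rewrite integral_mkcond; apply: eq_integral => x _.
by rewrite patchE indicE; case: ifPn => _; rewrite ?mul1e ?mul0e.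
Qed.

Lemma ge0_integral_density (f : T -> \bar R) :
  measurable_fun setT f -> (forall x, 0 <= f x)%E ->
  (\int[nu]_x f x = \int[mu]_x (f x * (h x)%:E))%E.
Proof.
move=> mf f0; pose g := nnsfun_approx measurableT mf.
have mmh : measurable_fun setT (fun x => (h x)%:E) by exact/measurable_EFinP.
transitivity (limn (fun n => \int[nu]_x (g n x)%:E))%E.
  rewrite -monotone_convergence//=.
  - by apply: eq_integral => x _; apply/esym/cvg_lim => //; exact: cvg_nnsfun_approx.
  - by move=> n; exact/measurable_EFinP.
  - by move=> n x _; rewrite lee_fin.
  - by move=> x _ a b ab; rewrite lee_fin; exact/lefP/nd_nnsfun_approx.
under eq_fun do rewrite integral_density_nnsfun.
rewrite -monotone_convergence//=.
- apply: eq_integral => x _; apply/cvg_lim => //.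
  by apply: cvgeZr => //; exact: cvg_nnsfun_approx.
- by move=> n; apply: emeasurable_funM => //; exact/measurable_EFinP.
- by move=> n x _; rewrite mule_ge0 ?lee_fin.
- move=> x _ a b ab; rewrite lee_wpmul2r ?lee_fin//.
  exact/lefP/nd_nnsfun_approx.
Qed.
End density.

Section gaussian_integral.
Context (R : realType).
Implicit Types (s a c : R).

(** Completing the square: the integrand times the density is a constant times the normal density of
    variance s^2 / D and mean a s^2 / D, where D = 1 - 2 c s^2. *)
Lemma normal_prob_expR_quadratic s a c : 0 < s -> 2 * c * s ^+ 2 < 1 ->
  (\int[normal_prob 0 s]_x (expR (a * x + c * x ^+ 2))%:E =
   ((Num.sqrt (1 - 2 * c * s ^+ 2))^-1 *
    expR (a ^+ 2 * s ^+ 2 / (2 * (1 - 2 * c * s ^+ 2))))%:E)%E.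
Proof.
move=> s0 cs.
have mf : measurable_fun setT (fun x : R => expR (a * x + c * x ^+ 2)).
  apply: measurableT_comp => //; apply: measurable_funD.
    exact: measurable_funM.
  by apply: measurable_funM => //; exact: measurable_funX.
rewrite (@ge0_integral_density _ _ _ lebesgue_measure _ (normal_pdf 0 s))//; first last.
  - exact/measurable_EFinP.
  - exact: normal_pdf_ge0.
  - exact: measurable_normal_pdf.
set D := 1 - 2 * c * s ^+ 2.
have D0 : 0 < D by rewrite subr_gt0.
pose s' := s / Num.sqrt D; pose m := a * s' ^+ 2.
have s'0 : 0 < s' by rewrite divr_gt0// sqrtr_gt0.
have s'2 : s' ^+ 2 = s ^+ 2 / D by rewrite expr_div_n sqr_sqrtr// ltW.
set K := (Num.sqrt D)^-1 * expR _.
transitivity (\int[lebesgue_measure]_x (K%:E * (normal_pdf m s' x)%:E))%E; last first.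
  rewrite ge0_integralZl//; first by rewrite integral_normal_pdf mule1.
  - by apply/measurable_EFinP; exact: measurable_normal_pdf.
  - by move=> x _; rewrite lee_fin normal_pdf_ge0.
  - by rewrite lee_fin mulr_ge0 ?expR_ge0// invr_ge0 sqrtr_ge0.
apply: eq_integral => x _; rewrite -!EFinM; congr EFin.
rewrite !normal_pdfE ?gt_eqF//.
have -> : normal_peak s' = normal_peak s * Num.sqrt D.
  rewrite /normal_peak s'2 -[in LHS]mulr_natr.
  have -> : s ^+ 2 / D * pi * 2%:R = (s ^+ 2 * pi *+ 2) / D.
    by rewrite -[in RHS]mulr_natr; field; rewrite gt_eqF.
  by rewrite sqrtrM ?sqrtrV ?invfM ?invrK ?ltW// mulrn_wgt0// mulr_gt0 ?pi_gt0// exprn_gt0.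
have sD : Num.sqrt D != 0 by rewrite gt_eqF// sqrtr_gt0.
rewrite /K /normal_fun.
have -> : (Num.sqrt D)^-1 * expR (a ^+ 2 * s ^+ 2 / (2 * D)) * (normal_peak s * Num.sqrt D *
   expR (- (x - m) ^+ 2 / (s' ^+ 2 *+ 2))) = normal_peak s *
   (expR (a ^+ 2 * s ^+ 2 / (2 * D)) * expR (- (x - m) ^+ 2 / (s' ^+ 2 *+ 2))).
  by field.
rewrite mulrCA -!expRD; congr (_ * expR _).
rewrite subr0 /m s'2 /D; field.
by rewrite -/D !gt_eqF.
Qed.
End gaussian_integral.

Section independence.
Context d (T : measurableType d) (R : realType) (P : probability T R).
Context d1 d2 (S1 : measurableType d1) (S2 : measurableType d2).
Variables (U : {mfun T >-> S1}) (Y : {mfun T >-> S2}) (N : probability S2 R).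
Hypothesis UY : forall A B, measurable A -> measurable B ->
  P (U @^-1` A `&` Y @^-1` B) = (P (U @^-1` A) * N B)%E.

Let UYfun : T -> S1 * S2 := fun w => (U w, Y w).
Let mUY : measurable_fun setT UYfun.
Proof. exact/measurable_fun_pair. Qed.
HB.instance Definition _ := isMeasurableFun.Build _ _ _ _ UYfun mUY.

(** The joint law of [U] and [Y] is the product measure, by uniqueness on rectangles. *)
Lemma independent_tonelli (f : S1 * S2 -> \bar R) :
  measurable_fun setT f -> (forall z, 0 <= f z)%E ->
  (\int[P]_w f (U w, Y w) = \int[P]_w \int[N]_y f (U w, y))%E.
Proof.
move=> mf f0.
rewrite -(@ge0_integral_distribution _ _ _ _ _ P UYfun f)//.
transitivity (\int[distribution P U \x N]_z f z)%E.
  apply: eq_measure_integral => A mA _; apply/esym.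
  by apply: product_measure_unique => //= A1 B1 mA1 mB1; exact: UY.
rewrite fubini_tonelli1//.
have := @measurable_fun_fubini_tonelli_F _ _ _ _ _ N f mf f0.
rewrite /fubini_F => mF.
rewrite (@ge0_integral_distribution _ _ _ _ _ P U (fun x => \int[N]_y f (x, y))%E)//.
by move=> y; exact: integral_ge0.
Qed.
End independence.

Section gaussian_noise.
Context d (T : measurableType d) (R : realType) (P : probability T R).
Variables (sigma : R) (W : nat -> {RV P >-> R}).
Hypothesis sigma0 : 0 < sigma.
Hypothesis Wind : mutually_independent W.
Hypothesis Wlaw : forall n, has_normal_law (W n) 0 sigma.

(** A pi-system generating the past of the noise before index [m]. The notation [past m] puts the
    generated sigma-algebra on the carrier [T], so that being determined by the past is
    measurability of a function on [past m]. *)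
Definition noise_cylinders (m : nat) : set (set T) :=
  [set A | exists2 B : nat -> set R, (forall j, measurable (B j)) &
     A = \bigcap_(j in [set` iota 0 m]) (W j @^-1` B j)].

Notation past m := (g_sigma_algebraType (noise_cylinders m)).

Lemma noise_cylinders_measurable m : noise_cylinders m `<=` measurable.
Proof.
move=> A [B mB ->]; apply: fin_bigcap_measurable => // j _.
exact: measurable_funPTI.
Qed.

Lemma past_measurable m (A : set T) : measurable (A : set (past m)) ->
  measurable A.
Proof.
apply: smallest_sub; first exact: sigma_algebra_measurable.
exact: noise_cylinders_measurable.
Qed.

Lemma measurable_noise_past m j : (j < m)%N ->
  measurable_fun setT (W j : past m -> R).
Proof.
move=> jm _ B mB; rewrite setTI; apply: sub_sigma_algebra.
exists (fun i => if i == j then B else setT).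
  by move=> i; case: ifP.
apply/seteqP; split => [x Bx i /= _|x].
  by case: eqP => [->|].
by move/(_ j); rewrite eqxx; apply; rewrite /= mem_iota.
Qed.

(** Mutual independence gives the identity on cylinders; both sides are finite measures in [A], so
    it extends to the sigma-algebra they generate. *)
Lemma past_noise_independent m (A : set T) (B : set R) :
  measurable (A : set (past m)) -> measurable B ->
  P (A `&` W m @^-1` B) = (P A * normal_prob 0 sigma B)%E.
Proof.
move=> mA mB.
have mWB : measurable (W m @^-1` B) by exact: measurable_funPTI.
have N0 : 0 <= fine (normal_prob 0 sigma B).
  by rewrite fine_ge0//; exact: measure_ge0.
have Nfin : (fine (normal_prob 0 sigma B))%:E = normal_prob 0 sigma B.
  by rewrite fineK//; exact: fin_num_measure.
pose m1 := mrestr P mWB.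
pose m2 : {measure set T -> \bar R} := mscale (NngNum N0) P.
have -> : P (A `&` W m @^-1` B) = m1 A by [].
have -> : (P A * normal_prob 0 sigma B)%E = m2 A.
  by rewrite /m2/= /mscale/= Nfin muleC.
apply: (@g_sigma_algebra_measure_unique _ _ _ (noise_cylinders m) _ (fun=> setT)) => //.
- exact: noise_cylinders_measurable.
- move=> _; exists (fun=> setT) => //.
  by rewrite bigcap1 preimage_setT// || (apply/seteqP; split => // x _ i).
- by rewrite bigcup_const//; exists 0%N.
- move=> _ _ [B1 mB1 ->] [B2 mB2 ->]; exists (fun j => B1 j `&` B2 j).
    by move=> j; exact: measurableI.
  apply/seteqP; split => [x [h1 h2] i im|x h].
    by split; [exact: h1|exact: h2].
  by split => i /h[].
- move=> _ [C mC ->]; rewrite /m1 /m2/= /mrestr /mscale/= Nfin.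
  (* With [B] inserted at index [m], the intersection becomes a single cylinder over [m.+1]
     indices. *)
  pose D j := if j == m then B else C j.
  have mD j : measurable (D j) by rewrite /D; case: ifP.
  have := @Wind (iota 0 m.+1) D (iota_uniq _ _) mD.
  have := @Wind (iota 0 m) D (iota_uniq _ _) mD.
  have -> : \bigcap_(j in [set` iota 0 m]) (W j @^-1` D j) =
            \bigcap_(j in [set` iota 0 m]) (W j @^-1` C j).
    apply: eq_bigcapr => j /=; rewrite mem_iota add0n => /ltn_eqF jm.
    by rewrite /D jm.
  move=> ->.
  have -> : \bigcap_(j in [set` iota 0 m.+1]) (W j @^-1` D j) =
            (\bigcap_(j in [set` iota 0 m]) (W j @^-1` C j)) `&` W m @^-1` B.
    rewrite -addn1 iotaD add0n.
    apply/seteqP; split => [x h|x [h Bx] j /=].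
      split; last first.
        by move: (h m); rewrite /D eqxx; apply; rewrite /= mem_cat mem_head orbT.
      move=> j /= jm; have := h j; rewrite /= mem_cat jm => /(_ isT).
      by move: jm; rewrite mem_iota add0n /D => /ltn_eqF ->.
    rewrite mem_cat mem_seq1 orbC /D; case: eqP => [->//|_/=]; exact: h.
  move=> ->; rewrite -[in LHS]addn1 iotaD add0n big_cat/= big_seq1 muleC.
  by congr (_ * _)%E; rewrite /D eqxx -(Wlaw m mB).
- move=> _; rewrite /m1/= /mrestr.
  by rewrite (le_lt_trans (probability_le1 _ _)) ?ltry//; exact: measurableI.
Qed.

(** The identity of [T] as a random variable valued in the past: its independence from [W m] makes
    Tonelli an integration conditional on the past. *)
Let to_past m : T -> past m := id.
Let measurable_to_past m : measurable_fun setT (to_past m).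
Proof. by move=> _ B mB; rewrite setTI; exact: (@past_measurable m B mB). Qed.
HB.instance Definition _ m :=
  isMeasurableFun.Build _ _ _ _ (to_past m) (@measurable_to_past m).

Let noise m : T -> measurableTypeR R := W m.
Let measurable_noise m : measurable_fun setT (noise m).
Proof. by move=> _ B mB; exact: (@measurable_funPT _ _ _ _ (W m) measurableT B mB). Qed.
HB.instance Definition _ m :=
  isMeasurableFun.Build _ _ _ _ (noise m) (@measurable_noise m).

Lemma noise_tonelli m (f : past m * R -> \bar R) :
  measurable_fun setT f -> (forall z, 0 <= f z)%E ->
  (\int[P]_w f (w, W m w) = \int[P]_w \int[normal_prob 0 sigma]_y f (w, y))%E.
Proof.
move=> mf f0.
have := @independent_tonelli _ _ _ P _ _ (past m) (measurableTypeR R)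
  (to_past m : {mfun T >-> past m}) (noise m : {mfun T >-> measurableTypeR R})
  (normal_prob 0 sigma).
apply => //; exact: past_noise_independent.
Qed.

(** Given the past, [Z] and [A] are constants. The case c = 0 gives the exponential martingale, the
    case A = 0 the exponential moments of the squared noise. *)
Lemma expectation_expR_noise m (Z A : T -> R) (c : R) :
  measurable_fun setT (Z : past m -> R) ->
  measurable_fun setT (A : past m -> R) -> 2 * c * sigma ^+ 2 < 1 ->
  (\int[P]_w (expR (Z w + A w * W m w + c * W m w ^+ 2))%:E =
   ((Num.sqrt (1 - 2 * c * sigma ^+ 2))^-1)%:E *
   \int[P]_w (expR (Z w + A w ^+ 2 * sigma ^+ 2 /
                           (2 * (1 - 2 * c * sigma ^+ 2))))%:E)%E.
Proof.
move=> mZ mA cs.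
pose f (z : past m * R) : \bar R :=
  (expR (Z z.1 + A z.1 * z.2 + c * z.2 ^+ 2))%:E.
have mf : measurable_fun setT f.
  apply/measurable_EFinP; apply: measurableT_comp => //.
  apply: measurable_funD; last first.
    by apply: measurable_funM => //; exact: measurable_funX.
  apply: measurable_funD; first exact: (measurableT_comp mZ).
  by apply: measurable_funM => //; exact: (measurableT_comp mA).
rewrite (@noise_tonelli m f)//; last by move=> z; rewrite lee_fin expR_ge0.
have past_fun (g : T -> R) : measurable_fun setT (g : past m -> R) ->
    measurable_fun setT g.
  by move=> mg _ B mB; apply: (@past_measurable m); exact: mg.
rewrite -ge0_integralZl//; last first.
  apply/measurable_EFinP; apply: measurableT_comp => //.
  apply: measurable_funD; first exact: past_fun.
  do 2! apply: measurable_funM => //.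
  by apply: measurable_funX; exact: past_fun.
apply: eq_integral => w _; rewrite /f/=.
transitivity (\int[normal_prob 0 sigma]_y
  ((expR (Z w))%:E * (expR (A w * y + c * y ^+ 2))%:E))%E.
  by apply: eq_integral => y _; rewrite -EFinM -expRD addrA.
rewrite ge0_integralZl//; last first.
  apply/measurable_EFinP; apply: measurableT_comp => //.
  apply: measurable_funD; first exact: measurable_funM.
  by apply: measurable_funM => //; exact: measurable_funX.
by rewrite normal_prob_expR_quadratic// -!EFinM expRD; congr EFin; ring.
Qed.

Lemma exponential_martingale (Y : nat -> T -> R) (s : R) n :
  (forall k m, (k < m)%N -> measurable_fun setT (Y k : past m -> R)) ->
  (\int[P]_w (expR (s * (\sum_(k < n) W k.+1 w * Y k w) -
     s ^+ 2 * sigma ^+ 2 / 2 * (\sum_(k < n) Y k w ^+ 2)))%:E = 1)%E.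
Proof.
move=> mY; elim: n => [|n IH].
  under eq_integral do rewrite !big_ord0 !mulr0 subr0 expR0.
  by rewrite integral_cst// mul1e; exact: probability_setT.
have mW k m : (k < m)%N -> measurable_fun setT (W k : past m -> R).
  exact: measurable_noise_past.
(* The compensator runs one index ahead of the martingale: its last term is known before [W n.+1]
   and cancels the Gaussian factor produced by integrating [W n.+1]. *)
pose Z w := s * (\sum_(k < n) W k.+1 w * Y k w) -
     s ^+ 2 * sigma ^+ 2 / 2 * (\sum_(k < n.+1) Y k w ^+ 2).
have mZ : measurable_fun setT (Z : past n.+1 -> R).
  apply: measurable_funB; apply: measurable_funM => //; apply: measurable_sum => k.
    apply: measurable_funM; first by apply: mW; rewrite ltnS.
    by apply: mY; rewrite ltnS ltnW.
  by apply: measurable_funX; apply: mY.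
have mA : measurable_fun setT ((fun w => s * Y n w) : past n.+1 -> R).
  by apply: measurable_funM => //; exact: mY.
transitivity (\int[P]_w (expR (Z w + s * Y n w * W n.+1 w +
    0 * W n.+1 w ^+ 2))%:E)%E.
  apply: eq_integral => w _; congr (expR _)%:E.
  by rewrite /Z !big_ord_recr/=; ring.
rewrite expectation_expR_noise ?mulr0 ?mul0r//.
rewrite subr0 sqrtr1 invr1 mul1e -[RHS]IH.
apply: eq_integral => w _; congr (expR _)%:E.
by rewrite /Z big_ord_recr/=; field.
Qed.

Lemma expectation_expR_noise_sqr (c : R) i n : 2 * c * sigma ^+ 2 < 1 ->
  (\int[P]_w (expR (c * \sum_(k < n) W (k + i)%N w ^+ 2))%:E =
   ((Num.sqrt (1 - 2 * c * sigma ^+ 2))^-1 ^+ n)%:E)%E.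
Proof.
move=> cs; elim: n => [|n IH].
  under eq_integral do rewrite big_ord0 mulr0 expR0.
  by rewrite integral_cst// mul1e; exact: probability_setT.
have mZ : measurable_fun setT
    ((fun w => c * \sum_(k < n) W (k + i)%N w ^+ 2) : past (n + i) -> R).
  apply: measurable_funM => //; apply: measurable_sum => k.
  by apply: measurable_funX; apply: measurable_noise_past; rewrite ltn_add2r.
transitivity (\int[P]_w (expR (c * \sum_(k < n) W (k + i)%N w ^+ 2 +
    0 * W (n + i)%N w + c * W (n + i)%N w ^+ 2))%:E)%E.
  apply: eq_integral => w _; congr (expR _)%:E.
  by rewrite !big_ord_recr/=; ring.
rewrite expectation_expR_noise// [in RHS]exprS [in RHS]EFinM -IH; congr (_ * _)%E.
apply: eq_integral => w _; congr (expR _)%:E.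
by rewrite expr2 mul0r !mul0r addr0.
Qed.

(** With y = 2 c sigma^2 this is (1 - y)^(-1/2) <= exp (y / 2 + y^2), which follows from (1 + y + 2
    y^2) (1 - y) >= 1 for y <= 1/2. The linear term is exact, so that it cancels when the energy is
    centred. *)
Lemma expectation_expR_noise_sqr_le (c : R) i n : `|2 * c * sigma ^+ 2| <= 1 / 2 ->
  (\int[P]_w (expR (c * \sum_(k < n) W (k + i)%N w ^+ 2))%:E <=
   (expR ((c * sigma ^+ 2 + (2 * c * sigma ^+ 2) ^+ 2) * n%:R))%:E)%E.
Proof.
rewrite ler_norml => /andP[c1 c2].
rewrite expectation_expR_noise_sqr; last by lra.
set y := 2 * c * sigma ^+ 2 in c1 c2 *.
rewrite lee_fin expRM_natr; apply: lerXn2r; rewrite ?nnegrE ?expR_ge0//.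
have -> : c * sigma ^+ 2 = y / 2 by rewrite /y; field.
have y1 : 0 < 1 - y by lra.
have sy : 0 < Num.sqrt (1 - y) by rewrite sqrtr_gt0.
rewrite -[leLHS]mul1r ler_pdivrMr//.
have e0 := expR_gt0 (y / 2 + y ^+ 2).
rewrite -(@ler_pXn2r _ 2) ?nnegrE ?mulr_ge0 ?(ltW sy) ?(ltW e0)//.
rewrite expr1n exprMn sqr_sqrtr ?(ltW y1)// -expRM_natl.
have -> : 2%:R * (y / 2 + y ^+ 2) = y + 2 * y ^+ 2 by field.
apply: (@le_trans _ _ ((1 + (y + 2 * y ^+ 2)) * (1 - y))); last first.
  by rewrite ler_pM2r// expR_ge1Dx.
have -> : (1 + (y + 2 * y ^+ 2)) * (1 - y) = 1 + y ^+ 2 * (1 - 2 * y) by ring.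
by rewrite lerDl mulr_ge0 ?sqr_ge0//; lra.
Qed.

Lemma expectation_expR_noise_sqr1 (c : R) n : 2 * c * sigma ^+ 2 < 1 ->
  (\int[P]_w (expR (c * W n w ^+ 2))%:E =
   ((Num.sqrt (1 - 2 * c * sigma ^+ 2))^-1)%:E)%E.
Proof.
move=> cs.
transitivity (\int[P]_w (expR (0 + 0 * W n w + c * W n w ^+ 2))%:E)%E.
  by apply: eq_integral => w _; rewrite mul0r !add0r.
rewrite (@expectation_expR_noise n (cst 0) (cst 0))//.
under eq_integral do rewrite /= expr2 !mul0r addr0 expR0.
by rewrite integral_cst//= !mul1e probability_setT mule1.
Qed.
End gaussian_noise.

(** * Superexponential negligibility and tightness *)

Section superexponential.
Context d (T : measurableType d) (R : realType) (P : probability T R).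
Variable b : nat -> R.
Hypothesis b_infty : b n @[n --> \oo] --> +oo.

(* The events [E n] are only covered by measurable sets: no measurability of
   [E n] itself has to be checked. *)
Definition rare (E : nat -> set T) := forall K : R, \forall n \near \oo,
  exists A, [/\ measurable A, E n `<=` A & (P A <= (expR (- (K * b n ^+ 2)))%:E)%E].

Definition negligible_seq (f : nat -> T -> R) := forall e : R, 0 < e ->
  rare (fun n => [set w | e < `|f n w|]).

Definition exp_tight (f : nat -> T -> R) := forall K : R, exists C : R,
  \forall n \near \oo, exists A, [/\ measurable A,
    [set w | C < `|f n w|] `<=` A & (P A <= (expR (- (K * b n ^+ 2)))%:E)%E].

Lemma b_sqr_infty (C : R) : \forall n \near \oo, C <= b n ^+ 2.
Proof.
near=> n.
have b1 : 1 <= b n by near: n; apply: (cvgryPge _).1.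
have bC : C <= b n by near: n; apply: (cvgryPge _).1.
by rewrite (le_trans bC)// expr2 ler_peMl// (le_trans ler01).
Unshelve. all: by end_near. Qed.

Lemma mul_expR_le (k c : R) (c0 : 0 < c) : \forall n \near \oo,
  k * expR (- (c * b n ^+ 2)) <= 1.
Proof.
near=> n.
have kb : k / c <= b n ^+ 2 by near: n; exact: b_sqr_infty.
rewrite expRN ler_pdivrMr ?expR_gt0// mul1r.
rewrite ler_pdivrMr// in kb; rewrite (le_trans kb)// mulrC.
by apply: le_trans (expR_ge1Dx _); rewrite lerDr.
Unshelve. all: by end_near. Qed.

Lemma rare_sub E F : (\forall n \near \oo, E n `<=` F n) -> rare F -> rare E.
Proof.
move=> EF rF K; near=> n.
have [A [mA FA PA]] : exists A, [/\ measurable A, F n `<=` A &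
  (P A <= (expR (- (K * b n ^+ 2)))%:E)%E] by near: n; exact: rF.
exists A; split => //; apply: subset_trans FA.
by near: n.
Unshelve. all: by end_near. Qed.

Lemma probability_setU_le (A B : set T) (x y : R) :
  measurable A -> measurable B ->
  (P A <= x%:E)%E -> (P B <= y%:E)%E -> (P (A `|` B) <= (x + y)%:E)%E.
Proof.
move=> mA mB Ax By; rewrite EFinD.
by apply: (le_trans (measureU2 _ mA mB)); exact: leeD.
Qed.

(** One unit of rate pays for the factor 2 of the union bound, as b_n tends to infinity; hence the
    levels [K + 1] below. *)
Lemma probability_setU_expR (K : R) : \forall n \near \oo,
  forall A B, measurable A -> measurable B ->
  (P A <= (expR (- ((K + 1) * b n ^+ 2)))%:E)%E ->
  (P B <= (expR (- ((K + 1) * b n ^+ 2)))%:E)%E ->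
  (P (A `|` B) <= (expR (- (K * b n ^+ 2)))%:E)%E.
Proof.
near=> n => A B mA mB PA PB.
apply: (le_trans (probability_setU_le mA mB PA PB)); rewrite lee_fin.
have h : 2 * expR (- (1 * b n ^+ 2)) <= 1.
  by near: n; exact: mul_expR_le.
rewrite mulrDl opprD expRD -mulrDr ler_piMr ?expR_ge0//.
by rewrite -mulr2n -mulr_natl.
Unshelve. all: by end_near. Qed.

Lemma rare_setU E F : rare E -> rare F -> rare (fun n => E n `|` F n).
Proof.
move=> rE rF K; near=> n.
have [A [mA EA PA]] : exists A, [/\ measurable A, E n `<=` A &
  (P A <= (expR (- ((K + 1) * b n ^+ 2)))%:E)%E] by near: n; exact: rE.
have [B [mB FB PB]] : exists A, [/\ measurable A, F n `<=` A &
  (P A <= (expR (- ((K + 1) * b n ^+ 2)))%:E)%E] by near: n; exact: rF.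
exists (A `|` B); split; [exact: measurableU|exact: setUSS|].
by move: A B mA mB PA PB {EA FB}; near: n; exact: probability_setU_expR.
Unshelve. all: by end_near. Qed.

Lemma negligible_tight f : negligible_seq f -> exp_tight f.
Proof. by move=> nf K; exists 1; exact: (nf 1 ltr01). Qed.

Lemma negligible_le f g : (forall n w, `|f n w| <= `|g n w|) ->
  negligible_seq g -> negligible_seq f.
Proof.
move=> fg ng e e0; apply: rare_sub (ng e e0).
by apply: nearW => n w /= /lt_le_trans; exact.
Qed.

Lemma negligible_ext f g : (\forall n \near \oo, f n =1 g n) ->
  negligible_seq f -> negligible_seq g.
Proof.
move=> fg nf e e0; apply: rare_sub (nf e e0).
by near=> n => w /=; have -> : f n =1 g n by near: n.
Unshelve. all: by end_near. Qed.

Lemma negligible_rare f g : rare (fun n => [set w | f n w != g n w]) ->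
  negligible_seq f -> negligible_seq g.
Proof.
move=> fg nf e e0; apply: rare_sub (rare_setU fg (nf e e0)).
by apply: nearW => n w /= eg; case: eqVneq => [->|_]; [right|left].
Qed.

Lemma negligibleD f g : negligible_seq f -> negligible_seq g ->
  negligible_seq (fun n w => f n w + g n w).
Proof.
move=> nf ng e e0; have e20 : 0 < e / 2 by rewrite divr_gt0.
apply: rare_sub (rare_setU (nf _ e20) (ng _ e20)).
apply: nearW => n w /= h; apply/orP; rewrite -implyNb -leNgt; apply/implyP => fw.
rewrite ltNge; apply/negP => gw; move: h; rewrite ltNge => /negP; apply.
by rewrite (splitr e) (le_trans (ler_normD _ _))// lerD.
Qed.

Lemma negligibleN f : negligible_seq f -> negligible_seq (fun n w => - f n w).
Proof. by apply: negligible_le => n w; rewrite normrN. Qed.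

Lemma negligibleB f g : negligible_seq f -> negligible_seq g ->
  negligible_seq (fun n w => f n w - g n w).
Proof. by move=> nf ng; apply: negligibleD => //; exact: negligibleN. Qed.

Lemma tightM f g : exp_tight f -> exp_tight g ->
  exp_tight (fun n w => f n w * g n w).
Proof.
move=> tf tg K; have [C hC] := tf (K + 1); have [D hD] := tg (K + 1).
exists (`|C| * `|D|); near=> n.
have [A [mA fA PA]] : exists A, [/\ measurable A, [set w | C < `|f n w|] `<=` A &
  (P A <= (expR (- ((K + 1) * b n ^+ 2)))%:E)%E] by near: n.
have [B [mB gB PB]] : exists A, [/\ measurable A, [set w | D < `|g n w|] `<=` A &
  (P A <= (expR (- ((K + 1) * b n ^+ 2)))%:E)%E] by near: n.
exists (A `|` B); split; first exact: measurableU.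
  move=> w /= h; apply: contrapT => /not_orP[nA nB].
  have fC : `|f n w| <= `|C|.
    by rewrite (le_trans _ (ler_norm _))// leNgt; apply/negP => /fA.
  have gD : `|g n w| <= `|D|.
    by rewrite (le_trans _ (ler_norm _))// leNgt; apply/negP => /gB.
  by move: h; rewrite normrM ltNge ler_pM.
by move: A B mA mB PA PB {fA gB}; near: n; exact: probability_setU_expR.
Unshelve. all: by end_near. Qed.

Lemma tightD f g : exp_tight f -> exp_tight g ->
  exp_tight (fun n w => f n w + g n w).
Proof.
move=> tf tg K; have [C hC] := tf (K + 1); have [D hD] := tg (K + 1).
exists (C + D); near=> n.
have [A [mA fA PA]] : exists A, [/\ measurable A, [set w | C < `|f n w|] `<=` A &
  (P A <= (expR (- ((K + 1) * b n ^+ 2)))%:E)%E] by near: n.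
have [B [mB gB PB]] : exists A, [/\ measurable A, [set w | D < `|g n w|] `<=` A &
  (P A <= (expR (- ((K + 1) * b n ^+ 2)))%:E)%E] by near: n.
exists (A `|` B); split; first exact: measurableU.
  move=> w /= h; apply: contrapT => /not_orP[nA nB].
  have fC : `|f n w| <= C by rewrite leNgt; apply/negP => /fA.
  have gD : `|g n w| <= D by rewrite leNgt; apply/negP => /gB.
  by move: h; rewrite ltNge (le_trans (ler_normD _ _))// lerD.
by move: A B mA mB PA PB {fA gB}; near: n; exact: probability_setU_expR.
Unshelve. all: by end_near. Qed.

(** The threshold [C] of [f] depends on [K], but [g] is small at every threshold, in particular at
    one chosen after [C]. *)
Lemma negligibleM f g : exp_tight f -> negligible_seq g ->
  negligible_seq (fun n w => f n w * g n w).
Proof.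
move=> tf ng e e0 K; have [C hC] := tf (K + 1).
have eC : 0 < e / (`|C| + 1) by rewrite divr_gt0// ltr_wpDl.
near=> n.
have [A [mA fA PA]] : exists A, [/\ measurable A, [set w | C < `|f n w|] `<=` A &
  (P A <= (expR (- ((K + 1) * b n ^+ 2)))%:E)%E] by near: n.
have [B [mB gB PB]] : exists A, [/\ measurable A,
  [set w | e / (`|C| + 1) < `|g n w|] `<=` A &
  (P A <= (expR (- ((K + 1) * b n ^+ 2)))%:E)%E] by near: n; exact: ng.
exists (A `|` B); split; first exact: measurableU.
  move=> w /= h; apply: contrapT => /not_orP[nA nB].
  have fC : `|f n w| <= `|C| + 1.
    rewrite (@le_trans _ _ C)//; first by rewrite leNgt; apply/negP => /fA.
    by rewrite (le_trans (ler_norm _))// lerDl.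
  have gD : `|g n w| <= e / (`|C| + 1) by rewrite leNgt; apply/negP => /gB.
  move: h; rewrite normrM ltNge => /negP; apply.
  rewrite [leRHS](_ : _ = (`|C| + 1) * (e / (`|C| + 1))); last first.
    by field; rewrite gt_eqF// ltr_wpDl.
  by rewrite ler_pM.
by move: A B mA mB PA PB {fA gB}; near: n; exact: probability_setU_expR.
Unshelve. all: by end_near. Qed.

Lemma rare0 : rare (fun=> set0).
Proof.
by move=> K; apply: nearW => n; exists set0; split => //; rewrite measure0 lee_fin expR_ge0.
Qed.

Lemma tight_cst (c : R) : exp_tight (fun _ _ => c).
Proof.
move=> K; exists `|c|; apply: nearW => n; exists set0; split => //.
- by move=> w /=; rewrite ltxx.
- by rewrite measure0 lee_fin expR_ge0.
Qed.

Lemma negligible_cvg (u : nat -> R) : u n @[n --> \oo] --> 0 ->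
  negligible_seq (fun n _ => u n).
Proof.
move=> u0 e e0; apply: rare_sub rare0.
near=> n => w /=; rewrite ltNge => /negP; apply.
by near: n; apply: (cvgr0_norm_le _ u0).
Unshelve. all: by end_near. Qed.

Lemma negligibleZ (c : R) f : negligible_seq f ->
  negligible_seq (fun n w => c * f n w).
Proof. exact: (negligibleM (tight_cst c)). Qed.

Lemma tight_near_cst f (c : R) : negligible_seq (fun n w => f n w - c) ->
  exp_tight f.
Proof.
move=> nf; have := tightD (negligible_tight nf) (tight_cst c).
by under eq_fun do under eq_fun do rewrite subrK.
Qed.

Lemma rare_near_cst_le f (c : R) : 0 < c ->
  negligible_seq (fun n w => f n w - c) -> rare (fun n => [set w | f n w <= c / 2]).
Proof.
move=> c0 nf; have c40 : 0 < c / 4 by rewrite divr_gt0.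
apply: rare_sub (nf _ c40); apply: nearW => n w /= h.
have : c / 4 < c - f n w by lra.
by move=> /lt_le_trans; apply; rewrite distrC ler_norm.
Qed.

Lemma negligible_inv f (c : R) : 0 < c ->
  negligible_seq (fun n w => f n w - c) ->
  negligible_seq (fun n w => (f n w)^-1 - c^-1).
Proof.
move=> c0 nf; have c20 : 0 < c ^+ 2 by rewrite exprn_gt0.
(* The cut-off removes the rare event where [f n] may be near 0; elsewhere the inverse is Lipschitz
   at [c] with constant 2 / c^2. *)
pose g n w := if f n w <= c / 2 then 0 else (f n w)^-1 - c^-1.
have rf := rare_near_cst_le c0 nf.
apply: (@negligible_rare g).
  by apply: rare_sub rf; apply: nearW => n w /=; rewrite /g; case: ifPn => //; rewrite eqxx.
apply: negligible_le (negligibleZ (2 / c ^+ 2) nf) => n w.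
rewrite /g; case: ifPn => [_|]; first by rewrite normr0.
rewrite -ltNge => cf; have f0 : 0 < f n w by rewrite (lt_trans _ cf)// divr_gt0.
have -> : (f n w)^-1 - c^-1 = (f n w * c)^-1 * (c - f n w).
  by field; rewrite !gt_eqF.
rewrite normrM [leRHS]normrM distrC ler_wpM2r//.
have fc0 : 0 <= (f n w * c)^-1 by rewrite invr_ge0 mulr_ge0// ltW.
have c20' : 0 <= 2 / c ^+ 2 by rewrite divr_ge0// ltW.
rewrite (ger0_norm fc0) (ger0_norm c20').
have -> : 2 / c ^+ 2 = (c / 2 * c)^-1 by field; rewrite gt_eqF.
by rewrite lef_pV2 ?posrE ?mulr_gt0// ler_pM2r// ltW.
Qed.


(** A constant in the form consumed by [near_cstD] and [near_cstM], so that limits of polynomial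
    expressions are assembled as proof terms. *)
Lemma near_cst (c : R) : negligible_seq (fun _ _ => c - c).
Proof.
by apply: negligible_cvg; rewrite subrr; exact: cvg_cst.
Qed.

Lemma near_cstD f g c c' : negligible_seq (fun n w => f n w - c) ->
  negligible_seq (fun n w => g n w - c') ->
  negligible_seq (fun n w => f n w + g n w - (c + c')).
Proof.
move=> nf ng; apply: negligible_ext (negligibleD nf ng).
by apply: nearW => n w; ring.
Qed.

Lemma near_cstM f g c c' : negligible_seq (fun n w => f n w - c) ->
  negligible_seq (fun n w => g n w - c') ->
  negligible_seq (fun n w => f n w * g n w - c * c').
Proof.
move=> nf ng.
have h := negligibleD (negligibleM (tight_near_cst nf) ng) (negligibleZ c' nf).
by apply: negligible_ext h; apply: nearW => n w; ring.
Qed.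

Lemma near_cstN f c : negligible_seq (fun n w => f n w - c) ->
  negligible_seq (fun n w => - f n w - - c).
Proof.
by apply: negligible_le => n w; rewrite -opprD normrN.
Qed.

Lemma near_cst_negligible f : negligible_seq f -> negligible_seq (fun n w => f n w - 0).
Proof. by apply: negligible_le => n w; rewrite subr0. Qed.

End superexponential.

(** * Moderate deviations by exponential tilting *)

Section expectation_bounds.
Context d (T : measurableType d) (R : realType) (P : probability T R).
Implicit Types (f g : T -> R) (a c K : R).

(** The shape [a * f + g] iterates along a right-nested sum; such sums are closed by a final [0]. *)
Lemma expectation_combination f g a : measurable_fun setT f ->
  measurable_fun setT g -> (forall w, 0 <= f w) -> (forall w, 0 <= g w) ->
  0 <= a -> (\int[P]_w (a * f w + g w)%:E =
             a%:E * \int[P]_w (f w)%:E + \int[P]_w (g w)%:E)%E.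
Proof.
move=> mf mg f0 g0 a0; under eq_integral do rewrite EFinD.
rewrite ge0_integralD//; last 4 first.
- by move=> w _; rewrite lee_fin mulr_ge0.
- by apply/measurable_EFinP; exact: measurable_funM.
- by move=> w _; rewrite lee_fin.
- exact/measurable_EFinP.
congr (_ + _)%E; under eq_integral do rewrite EFinM.
rewrite ge0_integralZl//; first exact/measurable_EFinP.
by move=> w _; rewrite lee_fin.
Qed.

Lemma ge0_expectation_le f g : measurable_fun setT f -> measurable_fun setT g ->
  (forall w, 0 <= f w) -> (forall w, f w <= g w) ->
  (\int[P]_w (f w)%:E <= \int[P]_w (g w)%:E)%E.
Proof.
move=> mf mg f0 fg; apply: ge0_le_integral => //.
- by move=> w _; rewrite lee_fin.
- exact/measurable_EFinP.
- exact/measurable_EFinP.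
- by move=> w _; rewrite lee_fin.
Qed.

Lemma measurable_ge_set f c : measurable_fun setT f ->
  measurable [set w | c <= f w].
Proof.
move=> mf; have -> : [set w | c <= f w] = f @^-1` `[c, +oo[.
  by apply/seteqP; split => w /=; rewrite in_itv/= andbT.
by rewrite -[X in measurable X]setTI; exact: mf.
Qed.

Lemma markov_bound f A c K : measurable_fun setT f -> (forall w, 0 <= f w) ->
  measurable A -> 0 < c -> (forall w, A w -> c <= f w) ->
  (\int[P]_w (f w)%:E <= K%:E)%E -> (P A <= (K / c)%:E)%E.
Proof.
move=> mf f0 mA c0 Af fK.
have : (c%:E * P A <= K%:E)%E.
  apply: le_trans fK; rewrite -integral_cst//.
  apply: le_trans (ge0_subset_integral P mA measurableT _ _ _) => //.
  - apply: ge0_le_integral => //.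
    + by move=> w _; rewrite lee_fin ltW.
    + by apply/measurable_EFinP; exact: measurable_funTS.
  - exact/measurable_EFinP.
  - by move=> w _; rewrite lee_fin.
rewrite -lee_pdivlMl// => /le_trans; apply.
by rewrite -EFinM lee_fin mulrC.
Qed.

End expectation_bounds.

Lemma double_le (R : realType) (k y : R) : 2 * k <= 1 -> 0 <= y ->
  k * y + k * y <= y.
Proof. by move=> k1 y0; rewrite -mulrDl ler_piMl//; lra. Qed.

(* Off the event where [q] is far from [v], tilting by [l = x / v] makes [Z]
   concentrate at [x]: each tail is compared with a further tilt by [+- m], and
   the exceptional event is handled by Cauchy-Schwarz in its AM-GM form. *)
Lemma tilt_pointwise (R : realType) (v x dl h B zw qw L : R) : 0 < v ->
  let l := x / v in let m := dl / v in
  let F l := expR (B * (l * zw - l ^+ 2 / 2 * qw)) in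
  0 <= B -> 0 < dl -> 0 < h -> (2 * `|l| * m + m ^+ 2) * h <= dl ^+ 2 / (2 * v) ->
  F l <= expR (B * (x ^+ 2 / (2 * v) + `|l| * dl + l ^+ 2 / 2 * h)) *
           (`|zw - x| < dl)%R%:R +
         (expR (- (dl ^+ 2 / (4 * v) * B)) * F (l + m) +
         (expR (- (dl ^+ 2 / (4 * v) * B)) * F (l - m) +
         (expR (- (L * B)) / 4 * F (4 * l) +
         (expR (- (L * B)) / 4 * expR (6 * l ^+ 2 * B * qw) +
          expR (L * B) / 2 * (h < `|qw - v|)%R%:R)))).
Proof.
move=> v0 l m F B0 dl0 h0 hh.
have nonneg a : 0 <= F a by exact: expR_ge0.
set t1 := _ * (_ < dl)%R%:R; set t2 := _ * F (l + m); set t3 := _ * F (l - m).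
set t4 := _ * F (4 * l); set t5 := _ * expR (6 * _ * _ * _).
have t1_ge0 : 0 <= t1 by rewrite mulr_ge0 ?expR_ge0.
have t2_ge0 : 0 <= t2 by rewrite mulr_ge0 ?expR_ge0.
have t3_ge0 : 0 <= t3 by rewrite mulr_ge0 ?expR_ge0.
have t4_ge0 : 0 <= t4 by rewrite mulr_ge0 ?divr_ge0 ?expR_ge0.
have t5_ge0 : 0 <= t5 by rewrite mulr_ge0 ?divr_ge0 ?expR_ge0.
have m0 : 0 < m by rewrite divr_gt0.
have l0 : 0 <= `|l| by [].
have lx : l * v = x by rewrite /l divfK// gt_eqF.
have mdl : m * v = dl by rewrite /m divfK// gt_eqF.
have lE : l = x / v by [].
have mE : m = dl / v by [].
clearbody l m.
have [qv_far|] := ltP h `|qw - v|.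
  rewrite mulr1.
  suff : F l <= t4 + t5 + expR (L * B) / 2 by lra.
  (* The constants come from forcing [X ^+ 2] to be the normalised weight [F (4 * l)]; what is left
     is [Y ^+ 2] = exp (6 l^2 B q), which involves the bracket alone. *)
  have Wsq : F l ^+ 2 <= (F (4 * l) + expR (6 * l ^+ 2 * B * qw)) / 2.
    set X := expR (B * (2 * l * zw - 4 * l ^+ 2 * qw)).
    set Y := expR (3 * l ^+ 2 * B * qw).
    have -> : F l ^+ 2 = X * Y.
      by rewrite /F /X /Y -expRM_natl -expRD; congr expR; field.
    have -> : F (4 * l) = X ^+ 2.
      by rewrite /F /X -expRM_natl; congr expR; field.
    have -> : expR (6 * l ^+ 2 * B * qw) = Y ^+ 2.
      by rewrite /Y -expRM_natl; congr expR; ring.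
    by have := sqr_ge0 (X - Y); nra.
  set E := expR (L * B).
  have E0 : 0 < E by exact: expR_gt0.
  have Einv : expR (- (L * B)) = E^-1 by rewrite expRN.
  have amgm : F l <= E^-1 / 2 * F l ^+ 2 + E / 2.
    have -> : E^-1 / 2 * F l ^+ 2 + E / 2 = (F l ^+ 2 + E ^+ 2) / (2 * E).
      by field; rewrite gt_eqF.
    rewrite ler_pdivlMr ?mulr_gt0//.
    by have := sqr_ge0 (F l - E); nra.
  apply: (le_trans amgm); rewrite lerD2r /t4 /t5 Einv -mulrDr.
  have -> : E^-1 / 4 * (F (4 * l) + expR (6 * l ^+ 2 * B * qw)) =
     E^-1 / 2 * ((F (4 * l) + expR (6 * l ^+ 2 * B * qw)) / 2) by field; rewrite gt_eqF.
  by rewrite ler_wpM2l// divr_ge0// invr_ge0 ltW.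
rewrite ler_norml mulr0 addr0 => /andP[hq qh].
have [zx|] := ltP `|zw - x| dl.
  suff : F l <= t1 by lra.
  rewrite /t1 zx mulr1 ler_expR ler_wpM2l//.
  have lz : l * (zw - x) <= `|l| * dl.
    by rewrite (le_trans (ler_norm _))// normrM ler_wpM2l// ltW.
  have : l ^+ 2 * (v - h) <= l ^+ 2 * qw by rewrite ler_wpM2l ?sqr_ge0//; lra.
  have -> : x ^+ 2 / (2 * v) = l ^+ 2 * v / 2.
    by rewrite lE; field; rewrite gt_eqF.
  have lxx : l * x = l ^+ 2 * v by rewrite -lx; ring.
  by move: lz; rewrite mulrBr lxx; lra.
(* The sign [s] selects the tail. The choice m = dl / v maximises m dl - m^2 v / 2, a gain of dl^2 /
   (2 v); the replacement of [qw] by [v] consumes at most half of it. *)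
have key (s : R) : `|s| = 1 -> dl <= s * (zw - x) ->
    F l <= expR (- (dl ^+ 2 / (4 * v) * B)) * F (l + s * m).
  move=> s1 sz; rewrite -expRD ler_expR.
  have ss : s ^+ 2 = 1 by rewrite -real_normK ?num_real// s1 expr1n.
  suff : l * zw - l ^+ 2 / 2 * qw + dl ^+ 2 / (4 * v) <=
     (l + s * m) * zw - (l + s * m) ^+ 2 / 2 * qw.
    move=> /(ler_wpM2l B0); rewrite mulrDr; lra.
  have -> : (l + s * m) ^+ 2 = l ^+ 2 + 2 * s * l * m + m ^+ 2.
    transitivity (l ^+ 2 + 2 * s * l * m + s ^+ 2 * m ^+ 2); first by ring.
    by rewrite ss mul1r.
  have sm : m * dl <= m * (s * (zw - x)) by rewrite ler_wpM2l// ltW.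
  have sl : `|2 * s * l * m + m ^+ 2| <= 2 * `|l| * m + m ^+ 2.
    rewrite (le_trans (ler_normD _ _))// !normrM s1 (gtr0_norm m0).
    by rewrite normr_nat mulr1 -expr2.
  have qvh : (2 * s * l * m + m ^+ 2) * (qw - v) <= dl ^+ 2 / (2 * v).
    apply: le_trans hh; rewrite (le_trans (ler_norm _))// normrM ler_pM//.
    by rewrite ler_norml hq.
  have e1 : dl ^+ 2 / (2 * v) = m * dl / 2 by rewrite mE; field; rewrite gt_eqF.
  have e2 : dl ^+ 2 / (4 * v) = m * dl / 4 by rewrite mE; field; rewrite gt_eqF.
  have e3 : m ^+ 2 * v = m * dl by rewrite -mdl; ring.
  have e4 : s * l * m * v = s * m * x by rewrite -lx; ring.
  by move: qvh; rewrite e1 e2; lra.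
rewrite ler_normr => /orP[zx|zx].
  by have := key 1 (normr1 _); rewrite !mul1r => /(_ zx); rewrite -/t2; lra.
by have := key (-1) (normrN1 _); rewrite !mulN1r => /(_ zx); rewrite -/t3; lra.
Qed.

Lemma ler_bound (R : realType) (a h c e : R) : h * (c * (a + 1)) <= e ->
  0 < c -> 0 < h -> a * h <= e / c.
Proof.
by move=> he c0 h0; rewrite ler_pdivlMr//; have := mulr_gt0 c0 h0; lra.
Qed.

Section tightness.
Context d (T : measurableType d) (R : realType) (P : probability T R).
Variable b : nat -> R.
Hypothesis b_infty : b n @[n --> \oo] --> +oo.

Lemma tight_of_exponential_moments (Z : nat -> T -> R) (C : R) :
  (forall n, measurable_fun setT (Z n)) ->
  (forall s, `|s| = 1 -> \forall n \near \oo,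
    (\int[P]_w (expR (b n ^+ 2 * (s * Z n w)))%:E <= (expR (C * b n ^+ 2))%:E)%E) ->
  exp_tight P b Z.
Proof.
move=> mZ EZ K; exists (K + C + 1); near=> n.
set B := b n ^+ 2; set y := K + C + 1.
have B0 : 0 <= B by exact: sqr_ge0.
have tail s : `|s| = 1 -> (\int[P]_w (expR (B * (s * Z n w)))%:E <=
    (expR (C * b n ^+ 2))%:E)%E ->
    (P [set w | (y <= s * Z n w)%R] <= (expR (- ((K + 1) * B)))%:E)%E.
  move=> s1 Es.
  have -> : expR (- ((K + 1) * B)) = expR (C * B) / expR (B * y).
    by rewrite -expRN -expRD; congr expR; rewrite /y; ring.
  have ms : measurable_fun setT (fun w => s * Z n w) by exact: measurable_funM.
  apply: (@markov_bound _ _ _ P (fun w => expR (B * (s * Z n w)))).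
  - by apply: measurableT_comp => //; exact: measurable_funM.
  - by move=> w; exact: expR_ge0.
  - exact: measurable_ge_set.
  - exact: expR_gt0.
  - by move=> w /= yZ; rewrite ler_expR ler_wpM2l.
  - exact: Es.
have P1 : (P [set w | (y <= 1 * Z n w)%R] <= (expR (- ((K + 1) * B)))%:E)%E.
  by apply: tail; [exact: normr1|rewrite /B; near: n; apply: EZ; exact: normr1].
have P2 : (P [set w | (y <= - 1 * Z n w)%R] <= (expR (- ((K + 1) * B)))%:E)%E.
  by apply: tail; [exact: normrN1|rewrite /B; near: n; apply: EZ; exact: normrN1].
have mS s : measurable [set w | y <= s * Z n w].
  by apply: measurable_ge_set; exact: measurable_funM.
exists ([set w | y <= 1 * Z n w] `|` [set w | y <= - 1 * Z n w]); split.
- exact: measurableU.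
- move=> w /= /ltW; rewrite ler_normr mul1r mulN1r => /orP[|]; by [left|right].
- have : forall A B, measurable A -> measurable B ->
    (P A <= (expR (- ((K + 1) * b n ^+ 2)))%:E)%E ->
    (P B <= (expR (- ((K + 1) * b n ^+ 2)))%:E)%E ->
    (P (A `|` B) <= (expR (- (K * b n ^+ 2)))%:E)%E.
    by near: n; exact: probability_setU_expR.
  by apply.
Unshelve. all: by end_near. Qed.

End tightness.

Section gaussian_moderate_deviations.
Context d (T : measurableType d) (R : realType) (P : probability T R).
Variable b : nat -> R.
Hypothesis b_infty : b n @[n --> \oo] --> +oo.
Variables (Z q : nat -> T -> R) (v C : R).
Hypothesis mZ : forall n, measurable_fun setT (Z n).
Hypothesis mq : forall n, measurable_fun setT (q n).

(** For Z = sum V Y / (b_n sqrt n) and q = sigma^2 sum Y^2 / n, this is the exponential martingale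
    with parameter s = l b_n / sqrt n. *)
Let W l n w := expR (b n ^+ 2 * (l * Z n w - l ^+ 2 / 2 * q n w)).
Let Eq c n w := expR (c * b n ^+ 2 * q n w).

Hypothesis EW : forall l, \forall n \near \oo, (\int[P]_w (W l n w)%:E = 1)%E.
Hypothesis Eqb : forall c, 0 <= c -> \forall n \near \oo,
  (\int[P]_w (Eq c n w)%:E <= (expR (C * c * b n ^+ 2))%:E)%E.
Hypothesis C0 : 0 <= C.
Hypothesis v0 : 0 < v.
Hypothesis qv : negligible_seq P b (fun n w => q n w - v).

Let mW l n : measurable_fun setT (W l n).
Proof.
apply: measurableT_comp => //; apply: measurable_funM => //.
by apply: measurable_funB; exact: measurable_funM.
Qed.

Let mEq c n : measurable_fun setT (Eq c n).
Proof. by apply: measurableT_comp => //; exact: measurable_funM. Qed.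

Let W0 l n w : 0 <= W l n w. Proof. exact: expR_ge0. Qed.
Let Eq0 c n w : 0 <= Eq c n w. Proof. exact: expR_ge0. Qed.

Lemma gaussian_upper_one_sided (l x e : R) (x0 : 0 < x) (e0 : 0 < e) :
    l = x / v \/ l = - (x / v) ->
  \forall n \near \oo, exists A, [/\ measurable A,
    [set w | x ^+ 2 / v <= l * Z n w] `<=` A &
    (P A <= (expR (- ((x ^+ 2 / (2 * v) - e) * b n ^+ 2)))%:E)%E].
Proof.
move=> lx; have l2 : l ^+ 2 = (x / v) ^+ 2 by case: lx => ->; rewrite ?sqrrN.
have xv0 : 0 < x / v by rewrite divr_gt0.
(* Then l^2 h / 2 = e / 2; the other half of [e] absorbs the union bound. *)
pose h := e / (x / v) ^+ 2.
have h0 : 0 < h by rewrite divr_gt0// exprn_gt0.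
near=> n.
have EWn : (\int[P]_w (W l n w)%:E = 1)%E by near: n.
have [B [mB qB PB]] : exists A, [/\ measurable A,
    [set w | h < `|q n w - v|] `<=` A &
    (P A <= (expR (- (x ^+ 2 / (2 * v) * b n ^+ 2)))%:E)%E].
  by near: n; exact: qv.
pose D := [set w | x ^+ 2 / v <= l * Z n w] `\` B.
have mD : measurable D.
  by apply: measurableD => //; apply: measurable_ge_set; exact: measurable_funM.
have PD : (P D <= (expR (- ((x ^+ 2 / (2 * v) - e / 2) * b n ^+ 2)))%:E)%E.
  have -> : expR (- ((x ^+ 2 / (2 * v) - e / 2) * b n ^+ 2)) =
            1 / expR (b n ^+ 2 * (x ^+ 2 / (2 * v) - e / 2)).
    by rewrite expRN mul1r mulrC.
  apply: (@markov_bound _ _ _ P (W l n)) => //; first exact: expR_gt0.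
    move=> w [/= lZ nB]; rewrite ler_expR ler_wpM2l ?sqr_ge0//.
    have qh : q n w <= v + h.
      rewrite -lerBlDl (le_trans (ler_norm _))// leNgt; apply/negP => /qB.
      exact: nB.
    have : l ^+ 2 / 2 * q n w <= l ^+ 2 / 2 * (v + h).
      by rewrite ler_wpM2l// divr_ge0// sqr_ge0.
    have -> : l ^+ 2 / 2 * (v + h) = x ^+ 2 / (2 * v) + e / 2.
      by rewrite l2 /h; field; rewrite !gt_eqF.
    have -> : x ^+ 2 / (2 * v) = x ^+ 2 / v / 2 by field; rewrite gt_eqF.
    lra.
  by rewrite EWn.
exists (D `|` B); split; first exact: measurableU.
  by move=> w lZ; have [wB|wB] := pselect (B w); [right|left].
apply: (le_trans (probability_setU_le mD mB PD PB)); rewrite lee_fin.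
have k : 2 * expR (- (e / 2 * b n ^+ 2)) <= 1.
  by near: n; apply: mul_expR_le => //; rewrite divr_gt0.
have kk : expR (- (x ^+ 2 / (2 * v) * b n ^+ 2)) <=
          expR (- ((x ^+ 2 / (2 * v) - e / 2) * b n ^+ 2)).
  by rewrite ler_expR lerN2 ler_wpM2r ?sqr_ge0// gerBl divr_ge0// ltW.
have -> : - ((x ^+ 2 / (2 * v) - e / 2) * b n ^+ 2) =
   - (e / 2 * b n ^+ 2) + - ((x ^+ 2 / (2 * v) - e) * b n ^+ 2) by field; rewrite gt_eqF.
rewrite (le_trans (lerD (lexx _) kk))//.
have -> : - ((x ^+ 2 / (2 * v) - e / 2) * b n ^+ 2) =
   - (e / 2 * b n ^+ 2) + - ((x ^+ 2 / (2 * v) - e) * b n ^+ 2) by field; rewrite gt_eqF.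
by rewrite expRD double_le ?expR_ge0.
Unshelve. all: by end_near. Qed.

Lemma gaussian_upper (x e : R) : 0 < x -> 0 < e ->
  \forall n \near \oo, exists A, [/\ measurable A,
    [set w | x <= `|Z n w|] `<=` A &
    (P A <= (expR (- ((x ^+ 2 / (2 * v) - e) * b n ^+ 2)))%:E)%E].
Proof.
move=> x0 e0; have e20 : 0 < e / 2 by rewrite divr_gt0.
near=> n.
have [A [mA ZA PA]] : exists A, [/\ measurable A,
    [set w | x ^+ 2 / v <= x / v * Z n w] `<=` A &
    (P A <= (expR (- ((x ^+ 2 / (2 * v) - e / 2) * b n ^+ 2)))%:E)%E].
  by near: n; apply: gaussian_upper_one_sided => //; left.
have [B [mB ZB PB]] : exists A, [/\ measurable A,
    [set w | x ^+ 2 / v <= - (x / v) * Z n w] `<=` A &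
    (P A <= (expR (- ((x ^+ 2 / (2 * v) - e / 2) * b n ^+ 2)))%:E)%E].
  by near: n; apply: gaussian_upper_one_sided => //; right.
exists (A `|` B); split; first exact: measurableU.
  move=> w /=; rewrite ler_normr => /orP[xZ|xZ]; [left; apply: ZA|right; apply: ZB].
    by rewrite /= expr2 mulrAC ler_wpM2l// ltW// divr_gt0.
  by rewrite /= expr2 mulrAC mulNr -mulrN ler_wpM2l// ltW// divr_gt0.
apply: (le_trans (probability_setU_le mA mB PA PB)); rewrite lee_fin.
have k : 2 * expR (- (e / 2 * b n ^+ 2)) <= 1.
  by near: n; apply: mul_expR_le.
have -> : - ((x ^+ 2 / (2 * v) - e / 2) * b n ^+ 2) =
   - (e / 2 * b n ^+ 2) + - ((x ^+ 2 / (2 * v) - e) * b n ^+ 2) by field; rewrite gt_eqF.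
by rewrite expRD double_le ?expR_ge0.
Unshelve. all: by end_near. Qed.


(** Integrating [tilt_pointwise] gives 1 <= c1 P(G) + remainder, where [G] is the event that [Z n]
    is within [dl] of [x]. With a remainder of at most 1/2, P(G) is at least 1 / (2 c1), and the
    smallness of [dl] and [h] brings c1 below exp ((x^2 / (2 v) + e / 2) b_n^2). *)
Lemma gaussian_lower (x dl0 e : R) : 0 < dl0 -> 0 < e ->
  \forall n \near \oo,
    ((expR (- ((x ^+ 2 / (2 * v) + e) * b n ^+ 2)))%:E <=
     P [set w | (`|Z n w - x| < dl0)%R])%E.
Proof.
move=> dl00 e0; pose l := x / v.
pose dl := Num.min dl0 (e / (4 * (`|l| + 1))).
have l1 : 0 < 4 * (`|l| + 1) by rewrite mulr_gt0// ltr_wpDl.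
have dlp : 0 < dl by rewrite lt_min dl00 divr_gt0.
have ldl : `|l| * dl <= e / 4.
  have : dl <= e / (4 * (`|l| + 1)) by rewrite ge_min lexx orbT.
  by rewrite ler_pdivlMr// => /ler_bound; apply => //; rewrite ltr0n.
pose m := dl / v; have m0 : 0 < m by rewrite divr_gt0.
have lm0 : 0 < 2 * `|l| * m + m ^+ 2.
  by apply: ltr_wpDl; [apply: mulr_ge0 => //; exact: ltW|exact: exprn_gt0].
have l20 : 0 < 2 * (l ^+ 2 + 1) by rewrite mulr_gt0// ltr_wpDl// sqr_ge0.
pose h := Num.min (e / (2 * (l ^+ 2 + 1))) (dl ^+ 2 / (2 * v) / (2 * `|l| * m + m ^+ 2)).
have h0 : 0 < h.
  by rewrite lt_min divr_gt0//= !divr_gt0// ?exprn_gt0// mulr_gt0.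
have lh : l ^+ 2 / 2 * h <= e / 4.
  have : h <= e / (2 * (l ^+ 2 + 1)) by rewrite ge_min lexx.
  by rewrite ler_pdivlMr// => /ler_bound/(_ (ltr0Sn _ 1) h0); rewrite mulrAC; lra.
have hh : (2 * `|l| * m + m ^+ 2) * h <= dl ^+ 2 / (2 * v).
  have : h <= dl ^+ 2 / (2 * v) / (2 * `|l| * m + m ^+ 2) by rewrite ge_min lexx orbT.
  by rewrite ler_pdivlMr// mulrC.
(* This [L] exceeds by 1 the exponential growth rate of the moment of [Eq (6 * l ^+ 2)]; the event
   [D] is then taken rare at level [L + 1]. Both products are of order exp (- B). *)
pose L := 6 * l ^+ 2 * C + 1.
have Cl0 : 0 <= 6 * l ^+ 2 * C by rewrite mulr_ge0// mulr_ge0// sqr_ge0.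
have k0 : 0 < dl ^+ 2 / (4 * v) by rewrite divr_gt0 ?exprn_gt0// mulr_gt0.
have c60 : 0 <= 6 * l ^+ 2 by rewrite mulr_ge0// sqr_ge0.
near=> n.
set B := b n ^+ 2.
have B0 : 0 <= B by exact: sqr_ge0.
pose G := [set w | `|Z n w - x| < dl]; pose D := [set w | h < `|q n w - v|].
have mlt (f : T -> R) (c : R) : measurable_fun setT f -> measurable [set w | c < f w].
  move=> mf; have -> : [set w | c < f w] = f @^-1` `]c, +oo[.
    by apply/seteqP; split => w /=; rewrite in_itv/= andbT.
  by rewrite -[X in measurable X]setTI; exact: mf.
have mG : measurable G.
  have -> : G = [set w | - dl < - `|Z n w - x|].
    by apply/seteqP; split => w /=; rewrite ltrN2.
  apply: mlt; apply: measurableT_comp => //; apply: measurableT_comp => //.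
  exact: measurable_funB.
have mD : measurable D.
  by apply: mlt; apply: measurableT_comp => //; exact: measurable_funB.
have PD : (P D <= (expR (- ((L + 1) * B)))%:E)%E.
  have [A [mA qA PA]] : exists A, [/\ measurable A,
      [set w | h < `|q n w - v|] `<=` A & (P A <= (expR (- ((L + 1) * b n ^+ 2)))%:E)%E].
    by near: n; exact: qv.
  by apply: le_trans PA; apply: le_measure => //; rewrite inE.
pose c1 := expR (B * (x ^+ 2 / (2 * v) + `|l| * dl + l ^+ 2 / 2 * h)).
pose kp := expR (- (dl ^+ 2 / (4 * v) * B)).
pose c4 := expR (- (L * B)) / 4.
pose c6 := expR (L * B) / 2.
have c10 : 0 <= c1 by exact: expR_ge0.
have kp0 : 0 <= kp by exact: expR_ge0.
have c40 : 0 <= c4 by rewrite divr_ge0// expR_ge0.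
have c6_0 : 0 <= c6 by rewrite divr_ge0// expR_ge0.
have tilt : (\int[P]_w (W l n w)%:E <= \int[P]_w (
    c1 * \1_G w + (kp * W (l + m) n w + (kp * W (l - m) n w +
    (c4 * W (4 * l) n w + (c4 * Eq (6 * l ^+ 2) n w +
    (c6 * \1_D w + 0))))))%:E)%E.
  apply: ge0_expectation_le => //; first by repeat (apply: measurable_funD || apply: measurable_funM) => //; exact: measurable_indic.
  move=> w; rewrite addr0.
  have -> : \1_G w = (`|Z n w - x| < dl)%R%:R :> R.
    by rewrite indicE; congr ((nat_of_bool _)%:R); apply/idP/idP; rewrite inE.
  have -> : \1_D w = (h < `|q n w - v|)%R%:R :> R.
    by rewrite indicE; congr ((nat_of_bool _)%:R); apply/idP/idP; rewrite inE.
  exact: (@tilt_pointwise R v x dl h B (Z n w) (q n w) L).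
have indic0 (A : set T) w : 0 <= \1_A w :> R by rewrite indicE.
have mI (A : set T) : measurable A -> measurable_fun setT (\1_A : T -> R).
  by move=> mA; exact: measurable_indic.
move: tilt.
have addr_ge0' (x1 x2 : T -> R) : (forall w, 0 <= x1 w) -> (forall w, 0 <= x2 w) ->
  forall w, 0 <= x1 w + x2 w by move=> h1 h2 w; rewrite addr_ge0.
have mulr_ge0' (a : R) (x1 : T -> R) : 0 <= a -> (forall w, 0 <= x1 w) ->
  forall w, 0 <= a * x1 w by move=> h1 h2 w; rewrite mulr_ge0.
have mM (a : R) (x1 : T -> R) : measurable_fun setT x1 -> measurable_fun setT (fun w => a * x1 w).
  by move=> mx; exact: measurable_funM.
have mA (x1 x2 : T -> R) : measurable_fun setT x1 -> measurable_fun setT x2 ->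
  measurable_fun setT (fun w => x1 w + x2 w) by exact: measurable_funD.
have m6 := mA _ _ (mM c6 _ (mI _ mD)) (measurable_cst (0 : R)).
have p6 := addr_ge0' _ _ (mulr_ge0' _ _ c6_0 (indic0 D)) (fun=> lexx 0).
have m5 := mA _ _ (mM c4 _ (mEq (6 * l ^+ 2) n)) m6.
have p5 := addr_ge0' _ _ (mulr_ge0' _ _ c40 (Eq0 (6 * l ^+ 2) n)) p6.
have m4 := mA _ _ (mM c4 _ (mW (4 * l) n)) m5.
have p4 := addr_ge0' _ _ (mulr_ge0' _ _ c40 (W0 (4 * l) n)) p5.
have m3 := mA _ _ (mM kp _ (mW (l - m) n)) m4.
have p3 := addr_ge0' _ _ (mulr_ge0' _ _ kp0 (W0 (l - m) n)) p4.
have m2 := mA _ _ (mM kp _ (mW (l + m) n)) m3.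
have p2 := addr_ge0' _ _ (mulr_ge0' _ _ kp0 (W0 (l + m) n)) p3.
rewrite (expectation_combination P (mI _ mG) m2 (indic0 G) p2 c10).
rewrite (expectation_combination P (mW (l + m) n) m3 (W0 _ n) p3 kp0).
rewrite (expectation_combination P (mW (l - m) n) m4 (W0 _ n) p4 kp0).
rewrite (expectation_combination P (mW (4 * l) n) m5 (W0 _ n) p5 c40).
rewrite (expectation_combination P (mEq (6 * l ^+ 2) n) m6 (Eq0 _ n) p6 c40).
rewrite (expectation_combination P (mI _ mD) (measurable_cst (0 : R)) (indic0 D) (fun=> lexx 0) c6_0).
rewrite !integral_indic// !setIT integral0 adde0.
have -> : (\int[P]_w (W l n w)%:E = 1)%E by near: n.
have -> : (\int[P]_w (W (l + m) n w)%:E = 1)%E by near: n.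
have -> : (\int[P]_w (W (l - m) n w)%:E = 1)%E by near: n.
have -> : (\int[P]_w (W (4 * l) n w)%:E = 1)%E by near: n.
have EE : (\int[P]_w (Eq (6 * l ^+ 2) n w)%:E <=
    (expR (C * (6 * l ^+ 2) * b n ^+ 2))%:E)%E by near: n; exact: Eqb.
have PGfin : P G = (fine (P G))%:E by rewrite fineK//; exact: fin_num_measure.
set p := fine (P G) in PGfin; rewrite !mule1 => tilt.
have {}tilt : 1 <= c1 * p + (kp + (kp + (c4 + (c4 * expR (C * (6 * l ^+ 2) * B) +
    c6 * expR (- ((L + 1) * B)))))).
  rewrite -lee_fin; apply: (le_trans tilt).
  rewrite !EFinD !EFinM -PGfin; apply: leeD; first exact: lexx.
  do 3 apply: leeD => //.
  by apply: leeD; apply: lee_wpmul2l => //; rewrite lee_fin.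
have t5 : c4 * expR (C * (6 * l ^+ 2) * B) = expR (- B) / 4.
  by rewrite /c4 mulrAC -expRD; congr (expR _ / _); rewrite /L; ring.
have t6 : c6 * expR (- ((L + 1) * B)) = expR (- B) / 2.
  by rewrite /c6 mulrAC -expRD; congr (expR _ / _); ring.
have t4 : c4 <= expR (- B) / 4.
  rewrite ler_pM2r ?invr_gt0// ler_expR lerN2 /L mulrDl mul1r lerDr.
  by rewrite mulr_ge0.
have kp8 : 8 * kp <= 1 by rewrite /kp /B; near: n; apply: mul_expR_le.
have B4 : 4 * expR (- (1 * B)) <= 1 by rewrite /B; near: n; apply: mul_expR_le.
have e2 : 2 * expR (- (e / 2 * B)) <= 1.
  by rewrite /B; near: n; apply: mul_expR_le => //; rewrite divr_gt0.
rewrite mul1r in B4.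
(* The two tails cost at most 1/8 each, the three exceptional terms together at most exp (- B) <=
   1/4. *)
have half : 1 / 2 <= c1 * p by rewrite t5 t6 in tilt; lra.
apply: (@le_trans _ _ (P G)); last first.
  apply: le_measure => //; rewrite ?inE//.
    have -> : [set w | `|Z n w - x| < dl0] = [set w | - dl0 < - `|Z n w - x|].
      by apply/seteqP; split => w /=; rewrite ltrN2.
    apply: mlt; apply: measurableT_comp => //; apply: measurableT_comp => //.
    exact: measurable_funB.
  by move=> w /= /lt_le_trans; apply; rewrite ge_min lexx.
rewrite PGfin lee_fin.
have c1e : c1 <= expR ((x ^+ 2 / (2 * v) + e / 2) * B).
  by rewrite ler_expR mulrC ler_wpM2r//; lra.
have p0 : 0 <= p by rewrite -lee_fin -PGfin measure_ge0.
have -> : - ((x ^+ 2 / (2 * v) + e) * B) = - (e / 2 * B) - (x ^+ 2 / (2 * v) + e / 2) * B.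
  by field; rewrite gt_eqF.
rewrite expRD expRN [X in _ * X]expRN; set E := expR (_ * B) in c1e *.
have E0 : 0 < E by exact: expR_gt0.
rewrite ler_pdivrMr//.
apply: (@le_trans _ _ (c1 * p)); last by rewrite mulrC ler_wpM2l.
by rewrite -expRN; lra.
Unshelve. all: by end_near. Qed.

(** AM-GM splits exp (B t Z), for a sign t, into the normalised weight [W (2 * t)] and an
    exponential moment of [q]. Such a bound is available before the limit of [q], whose proof relies
    on it. *)
Lemma gaussian_tight : exp_tight P b Z.
Proof.
move=> K; exists (K + 2 * C + 1); near=> n.
have E1 : (\int[P]_w (W 2 n w)%:E = 1)%E by near: n.
have E2 : (\int[P]_w (W (- 2) n w)%:E = 1)%E by near: n.
have E3 : (\int[P]_w (Eq 2 n w)%:E <= (expR (C * 2 * b n ^+ 2))%:E)%E.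
  by near: n; exact: Eqb.
set B := b n ^+ 2 in E3 *.
have B0 : 0 <= B by exact: sqr_ge0.
pose f w := 1 * W 2 n w + (1 * W (- 2) n w + (1 * Eq 2 n w + 0)).
have mM (x1 : T -> R) : measurable_fun setT x1 -> measurable_fun setT (fun w => 1 * x1 w).
  by move=> mx; exact: measurable_funM.
have m3 : measurable_fun setT (fun w => 1 * Eq 2 n w + 0).
  by apply: measurable_funD => //; exact: mM.
have m2 : measurable_fun setT (fun w => 1 * W (- 2) n w + (1 * Eq 2 n w + 0)).
  by apply: measurable_funD => //; exact: mM.
have mf : measurable_fun setT f.
  by apply: measurable_funD => //; exact: mM.
have Ef : (\int[P]_w (f w)%:E <= (2 + expR (C * 2 * B))%:E)%E.
  rewrite (expectation_combination P (mW 2 n) m2)//; last first.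
    by move=> w; rewrite !addr_ge0// mulr_ge0.
  rewrite (expectation_combination P (mW (- 2) n) m3)//; last first.
    by move=> w; rewrite !addr_ge0// mulr_ge0.
  rewrite (expectation_combination P (mEq 2 n) (measurable_cst (0 : R)))//.
  rewrite E1 E2 integral0 adde0 !mul1e !EFinD addeA.
  by apply: leeD.
pose A := [set w | (K + 2 * C + 1) <= `|Z n w|].
have mA : measurable A by apply: measurable_ge_set; exact: measurableT_comp.
exists A; split => //; first by move=> w /= /ltW.
pose y := K + 2 * C + 1.
have key w : A w -> 2 * expR (B * y) <= f w.
  move=> Aw.
  have amgm (t : R) : `|t| = 1 -> 2 * expR (B * (t * Z n w)) <= W (2 * t) n w + Eq 2 n w.
    move=> t1; have t2 : t ^+ 2 = 1 by rewrite -real_normK ?num_real// t1 expr1n.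
    pose X1 := expR (B * (t * Z n w - q n w)); pose X2 := expR (B * q n w).
    have -> : expR (B * (t * Z n w)) = X1 * X2.
      by rewrite -expRD; congr expR; ring.
    have -> : W (2 * t) n w = X1 ^+ 2.
      by rewrite /W /X1 -expRM_natl exprMn t2 mulr1 -/B; congr expR; field.
    have -> : Eq 2 n w = X2 ^+ 2.
      by rewrite /Eq /X2 -expRM_natl -/B; congr expR; ring.
    by have := sqr_ge0 (X1 - X2); rewrite sqrrB; lra.
  rewrite /f !mul1r addr0; move: Aw; rewrite /A /= ler_normr => /orP[yZ|yZ].
    have := amgm 1 (normr1 _); rewrite mulr1 mul1r => h1.
    have : expR (B * y) <= expR (B * Z n w) by rewrite ler_expR ler_wpM2l.
    by have := W0 (- 2) n w; lra.
  have := amgm (- 1) (normrN1 _); rewrite mulrN1 mulN1r => h1.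
  have : expR (B * y) <= expR (B * - Z n w) by rewrite ler_expR ler_wpM2l.
  by have := W0 2 n w; lra.
have f0 w : 0 <= f w by rewrite /f !addr_ge0// mulr_ge0.
have ey : 0 < 2 * expR (B * y) by rewrite mulr_gt0// expR_gt0.
apply: (le_trans (markov_bound mf f0 mA ey key Ef)); rewrite lee_fin.
rewrite ler_pdivrMr//.
have -> : expR (- (K * B)) * (2 * expR (B * y)) = 2 * (expR B * expR (C * 2 * B)).
  by rewrite mulrCA -!expRD; congr (_ * expR _); rewrite /y; ring.
have B2 : 2 * expR (- (1 * B)) <= 1 by rewrite /B; near: n; apply: mul_expR_le.
have eB : 2 <= expR B by move: B2; rewrite mul1r expRN ler_pdivrMr ?mul1r// expR_gt0.
have eC : 1 <= expR (C * 2 * B) by rewrite -[leLHS]expR0 ler_expR mulr_ge0// mulr_ge0.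
have : 2 * expR (C * 2 * B) <= expR B * expR (C * 2 * B) by rewrite ler_wpM2r// expR_ge0.
by lra.
Unshelve. all: by end_near. Qed.
End gaussian_moderate_deviations.

(** * Large deviation principles with a quadratic rate *)

Section ereal_facts.
Context (R : realType).
Implicit Types (x y : \bar R) (u : (\bar R)^nat).
Local Open Scope ereal_scope.

Lemma ereal_between x y : x < y -> exists r : R, x < r%:E < y.
Proof.
case: x => [x||]; case: y => [y||]//.
- rewrite lte_fin => xy; exists ((x + y) / 2)%R; rewrite !lte_fin.
  by apply/andP; split; lra.
- by move=> _; exists (x + 1)%R; rewrite lte_fin ltry andbT ltrDl.
- by move=> _; exists (y - 1)%R; rewrite ltNyr lte_fin gtrDl ltrN10.
- by move=> _; exists 0%R; rewrite ltNyr ltry.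
Qed.

Lemma near_limn_esup_le u x : (\forall n \near \oo, u n <= x) -> limn_esup u <= x.
Proof.
move=> ux; rewrite /limn_esup /limf_esup.
apply: (@le_trans _ _ (ereal_sup (u @` [set n | u n <= x]))).
  by apply: ereal_inf_lbound; exists [set n | u n <= x].
by apply: ge_ereal_sup => _ [n /= unx <-].
Qed.

Lemma near_le_limn_einf u x : (\forall n \near \oo, x <= u n) -> x <= limn_einf u.
Proof.
move=> xu; rewrite /limn_einf leeNr; apply: near_limn_esup_le.
by near do rewrite leeN2.
Unshelve. all: by end_near. Qed.

End ereal_facts.

Section quadratic_rate.
Context (R : realType) (v : R).
Hypothesis v0 : 0 <= v.

(** The level sets are segments [-s, s], with s = 0 when v = 0. Through this description the
    degenerate rate follows the same arguments as the others. *)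
Lemma quadratic_rate_level (a : R) : 0 <= a -> exists2 s : R, 0 <= s &
  forall x, (quadratic_rate v x <= a%:E)%E = (`|x| <= s).
Proof.
move=> a0; rewrite /quadratic_rate; have [_|vn0] := eqVneq v 0.
  by exists 0 => // x; rewrite normr_le0; case: eqP => // _; rewrite lee_fin.
have vp : 0 < 2 * v by rewrite mulr_gt0// lt_neqAle eq_sym vn0.
exists (Num.sqrt (a * (2 * v))) => [|x]; first exact: sqrtr_ge0.
rewrite lee_fin ler_pdivrMr// -sqrtr_sqr ler_psqrt// nnegrE ?sqr_ge0//.
by rewrite mulr_ge0// ltW.
Qed.

Lemma quadratic_rate_ge0 x : (0 <= quadratic_rate v x)%E.
Proof.
rewrite /quadratic_rate; case: ifP => _; first by case: ifP.
by rewrite lee_fin divr_ge0 ?sqr_ge0// mulr_ge0.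
Qed.

Lemma good_quadratic_rate : good_rate_function (quadratic_rate v).
Proof.
split; first exact: quadratic_rate_ge0.
- apply/lower_semicontinuousP => a; have [a0|a0] := leP 0 a; last first.
    rewrite [X in open X](_ : _ = setT); first exact: openT.
    apply/seteqP; split => // x _ /=; apply: lt_le_trans (quadratic_rate_ge0 x).
    by rewrite lte_fin.
  have [s s0 sE] := quadratic_rate_level a0.
  rewrite [X in open X](_ : _ = ~` `[- s, s]).
    by apply: closed_openC; exact: interval_closed.
  apply/seteqP; split => x /=; rewrite in_itv/= -ler_norml -sE ltNge; first by move/negP.
  by move/negP.
- move=> a; have [a0|a0] := leP 0 a; last first.
    rewrite [X in compact X](_ : _ = set0); first exact: compact0.
    apply/seteqP; split => // x /=; rewrite leNgt => /negP; apply.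
    by apply: lt_le_trans (quadratic_rate_ge0 x); rewrite lte_fin.
  have [s s0 sE] := quadratic_rate_level a0.
  rewrite [X in compact X](_ : _ = `[- s, s]%classic); first exact: segment_compact.
  by apply/seteqP; split => x /=; rewrite in_itv/= -ler_norml -sE.
Qed.

End quadratic_rate.

Section ldp_criterion.
Context d (T : measurableType d) (R : realType) (P : probability T R).
Variables (b : nat -> R) (D : nat -> {RV P >-> R}) (v : R).
Hypothesis b_infty : b n @[n --> \oo] --> +oo.
Hypothesis v0 : 0 <= v.
Hypothesis D_lower : forall x r e : R, (quadratic_rate v x < r%:E)%E -> 0 < e ->
  \forall n \near \oo, ((expR (- (r * b n ^+ 2)))%:E <=
     P [set w | (`|D n w - x| < e)%R])%E.
Hypothesis D_upper : forall x r : R, 0 < x -> (r%:E < quadratic_rate v x)%E ->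
  \forall n \near \oo, exists A, [/\ measurable A,
     [set w | x <= `|D n w|] `<=` A & (P A <= (expR (- (r * b n ^+ 2)))%:E)%E].

Let scaled_log_le (B x r : R) : 1 <= B ->
  (x%:E <= (expR (- (r * B)))%:E)%E -> 0 <= x -> (B^-1%:E * lne x%:E <= (- r)%:E)%E.
Proof.
move=> B1 xr x0; have B0 : 0 < B by exact: lt_le_trans B1.
rewrite lee_pdivrMl// -EFinM mulrN mulrC -[leRHS]expeRK.
by rewrite lee_lne// in_itv/= leey andbT lee_fin// expR_ge0.
Qed.

Let scaled_log_ge (B x r : R) : 1 <= B ->
  ((expR (- (r * B)))%:E <= x%:E)%E -> ((- r)%:E <= B^-1%:E * lne x%:E)%E.
Proof.
move=> B1 xr; have B0 : 0 < B by exact: lt_le_trans B1.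
rewrite lee_pdivlMl// -EFinM mulrN mulrC -[leLHS]expeRK.
have x0 : 0 <= x by rewrite -lee_fin; apply: le_trans xr; rewrite lee_fin expR_ge0.
by rewrite lee_lne// in_itv/= leey andbT lee_fin// expR_ge0.
Qed.

Let PE (A : set T) : measurable A -> P A = (fine (P A))%:E.
Proof. by move=> mA; rewrite fineK//; exact: fin_num_measure. Qed.

(** The rate is even and nondecreasing in |x|, so for the upper bound it suffices to control the
    tails of |D n|; the lower bound is local. *)
Theorem ldp_criterion : large_deviation_principle D (fun n => b n ^+ 2) (quadratic_rate v).
Proof.
split; first exact: good_quadratic_rate.
move=> B mB; have mDB n : measurable (D n @^-1` B) by exact: measurable_funPTI.
split; last 1 first.
- rewrite leeNr leNgt; apply/negP => /ereal_between[r0 /andP[]].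
  rewrite lteNl -EFinN; set r := - r0 => rlim rinf.
  move: rlim; apply/negP; rewrite -leNgt; apply: near_limn_esup_le.
  have [r00|r00] := leP 0 r0; last first.
    near=> n; rewrite (PE (mDB n)); have b1 : 1 <= b n ^+ 2 by near: n; exact: b_sqr_infty.
    rewrite /r; apply: scaled_log_le => //; last by rewrite fine_ge0.
    rewrite -PE// (le_trans (probability_le1 _ _))// lee_fin -[leLHS]expR0 ler_expR.
    by rewrite oppr_ge0 mulr_le0_ge0 ?sqr_ge0// ltW.
  have [s s0 sE] := quadratic_rate_level v0 r00.
  have Bs y : closure B y -> s < `|y|.
    move=> By; rewrite ltNge -sE -ltNge; apply: lt_le_trans rinf _.
    by apply: ereal_inf_lbound; exists y.
  (* The closure of [B] misses [-s, s]. Being closed, it also misses neighbourhoods of the endpoints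
     s and -s, which pushes [B] beyond s + e in absolute value. *)
  have nBs y : `|y| = s -> exists2 e : R, 0 < e & forall z, B z -> e <= `|y - z|.
    move=> ys; have : (~` closure B) y by move=> /Bs; rewrite ys ltxx.
    have /closed_openC : closed (closure B) by exact: closed_closure.
    rewrite openE => /(_ y) /[apply] /nbhs_ballP[e /= e0 eB].
    exists e => // z Bz; rewrite leNgt; apply/negP => yz.
    by apply: (eB z yz); exact: subset_closure.
  have [|e1 e10 h1] := nBs s; first by rewrite ger0_norm.
  have [|e2 e20 h2] := nBs (- s); first by rewrite normrN ger0_norm.
  pose e := Num.min e1 e2.
  have e0 : 0 < e by rewrite lt_min e10.
  have Be z : B z -> s + e <= `|z|.
    move=> Bz; have sz := Bs _ (subset_closure Bz).
    have := h1 z Bz; have := h2 z Bz.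
    have ee1 : e <= e1 by rewrite ge_min lexx.
    have ee2 : e <= e2 by rewrite ge_min lexx orbT.
    have [z0|z0] := leP 0 z.
      rewrite (ger0_norm z0) in sz *; rewrite [in X in _ -> X -> _]distrC.
      by rewrite (gtr0_norm (_ : 0 < z - s)) ?subr_gt0//; lra.
    rewrite (ltr0_norm z0) in sz *; rewrite (gtr0_norm (_ : 0 < - s - z)); last by lra.
    by move=> *; lra.
  have se0 : 0 < s + e by rewrite ltr_wpDl.
  have rI : (r0%:E < quadratic_rate v (s + e))%E.
    by rewrite ltNge sE -ltNge (ger0_norm (ltW se0)) ltrDl.
  near=> n.
  have b1 : 1 <= b n ^+ 2 by near: n; exact: b_sqr_infty.
  have [A [mA DA PA]] : exists A, [/\ measurable A,
      [set w | s + e <= `|D n w|] `<=` A & (P A <= (expR (- (r0 * b n ^+ 2)))%:E)%E].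
    by near: n; exact: D_upper.
  rewrite (PE (mDB n)) /r; apply: scaled_log_le => //; last by rewrite fine_ge0.
  rewrite -PE//; apply: le_trans PA; apply: le_measure; rewrite ?inE//.
  by move=> w /= /Be; exact: DA.
- rewrite leeNl; apply: le_ereal_inf_tmp => _ [x Bx <-].
  rewrite leNgt; apply/negP => /ereal_between[r /andP[Ir]]; rewrite lteNr -EFinN.
  apply/negP; rewrite -leNgt; apply: near_le_limn_einf.
  move: Bx => /nbhs_ballP[e /= e0 eB]; near=> n.
  have b1 : 1 <= b n ^+ 2 by near: n; exact: b_sqr_infty.
  rewrite (PE (mDB n)); apply: scaled_log_ge => //; rewrite -PE//.
  have : ((expR (- (r * b n ^+ 2)))%:E <= P [set w | (`|D n w - x| < e)%R])%E.
    by near: n; exact: D_lower.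
  move=> /le_trans; apply; apply: le_measure; rewrite ?inE//.
    have -> : [set w | (`|D n w - x| < e)%R] = D n @^-1` (ball x e).
      by apply/seteqP; split => w /=; rewrite /ball/= distrC.
    by apply: measurable_funPTI => //; exact: measurable_ball.
  by move=> w /= Dxe; apply: eB; rewrite /ball/= distrC.
- exact: limn_einf_sup.
Unshelve. all: by end_near. Qed.

End ldp_criterion.

Section exponential_equivalence.
Context d (T : measurableType d) (R : realType) (P : probability T R).
Variables (b : nat -> R) (D Z : nat -> T -> R) (v : R).
Hypothesis b_infty : b n @[n --> \oo] --> +oo.
Hypothesis v0 : 0 <= v.
Hypothesis mD : forall n, measurable_fun setT (D n).
Hypothesis mZ : forall n, measurable_fun setT (Z n).
Hypothesis DZ : negligible_seq P b (fun n w => D n w - Z n w).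

Lemma measurable_near (f : T -> R) (x e : R) : measurable_fun setT f ->
  measurable [set w | `|f w - x| < e].
Proof.
move=> mf; have -> : [set w | `|f w - x| < e] = f @^-1` (ball x e).
  by apply/seteqP; split => w /=; rewrite /ball/= distrC.
by rewrite -[X in measurable X]setTI; apply: mf => //; exact: measurable_ball.
Qed.

(** A probability of at least exp (- r' b_n^2) with r' < r loses at most half of itself when an
    event of probability exp (- r b_n^2) is removed. *)
Lemma lower_bound_transfer :
  (forall x r e : R, (quadratic_rate v x < r%:E)%E -> 0 < e ->
    \forall n \near \oo, ((expR (- (r * b n ^+ 2)))%:E <=
     P [set w | (`|Z n w - x| < e)%R])%E) ->
  forall x r e : R, (quadratic_rate v x < r%:E)%E -> 0 < e ->
    \forall n \near \oo, ((expR (- (r * b n ^+ 2)))%:E <=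
     P [set w | (`|D n w - x| < e)%R])%E.
Proof.
move=> Zl x r e /ereal_between[r' /andP[xr']]; rewrite lte_fin => r'r e0.
have e20 : 0 < e / 2 by rewrite divr_gt0.
have rr0 : 0 < r - r' by rewrite subr_gt0.
near=> n.
have h1 : ((expR (- (r' * b n ^+ 2)))%:E <= P [set w | (`|Z n w - x| < e / 2)%R])%E.
  by near: n; exact: Zl.
have [A [mA DA PA]] : exists A, [/\ measurable A,
    [set w | e / 2 < `|D n w - Z n w|] `<=` A &
    (P A <= (expR (- (r * b n ^+ 2)))%:E)%E] by near: n; exact: DZ.
have two : 2 * expR (- ((r - r') * b n ^+ 2)) <= 1 by near: n; exact: mul_expR_le.
have mD' := measurable_near x e (mD n).
have mZ' := measurable_near x (e / 2) (mZ n).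
have h2 : (P [set w | (`|Z n w - x| < e / 2)%R] <=
           P [set w | (`|D n w - x| < e)%R] + P A)%E.
  apply: le_trans (measureU2 _ mD' mA).
  apply: le_measure; rewrite ?inE//; first exact: measurableU.
  move=> w /= Zx; have [wA|wA] := pselect (A w); [by right|left].
  have DZw : `|D n w - Z n w| <= e / 2 by rewrite leNgt; apply/negP => /DA.
  rewrite (splitr e) -(subrK (Z n w) (D n w)) -addrA.
  by rewrite (le_lt_trans (ler_normD _ _))// ler_ltD.
have fP : P [set w | (`|D n w - x| < e)%R] =
    (fine (P [set w | (`|D n w - x| < e)%R]))%:E.
  by rewrite fineK//; exact: fin_num_measure.
have h3 := le_trans h1 (le_trans h2 (leeD (lexx _) PA)).
move: h3; rewrite fP -EFinD !lee_fin => h3.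
have h4 : 2 * expR (- (r * b n ^+ 2)) <= expR (- (r' * b n ^+ 2)).
  have -> : - (r * b n ^+ 2) = - ((r - r') * b n ^+ 2) + - (r' * b n ^+ 2) by ring.
  by rewrite expRD mulrA ler_piMl// expR_ge0.
lra.
Unshelve. all: by end_near. Qed.

Lemma upper_bound_transfer :
  (forall x r : R, 0 < x -> (r%:E < quadratic_rate v x)%E ->
    \forall n \near \oo, exists A, [/\ measurable A,
     [set w | x <= `|Z n w|] `<=` A & (P A <= (expR (- (r * b n ^+ 2)))%:E)%E]) ->
  forall x r : R, 0 < x -> (r%:E < quadratic_rate v x)%E ->
    \forall n \near \oo, exists A, [/\ measurable A,
     [set w | x <= `|D n w|] `<=` A & (P A <= (expR (- (r * b n ^+ 2)))%:E)%E].
Proof.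
move=> Zu x r x0 rx.
(* Room between y and x is needed for the discrepancy of [D] and [Z]; it exists since the strict
   inequality for the rate persists slightly to the left of x. *)
have [y [y0 yx ry]] : exists y, [/\ 0 < y, y < x & (r%:E < quadratic_rate v y)%E].
  have [r0|r0] := leP 0 r; last first.
    exists (x / 2); split; [by rewrite divr_gt0|lra|].
    by apply: lt_le_trans (quadratic_rate_ge0 v0 _); rewrite lte_fin.
  have [s s0 sE] := quadratic_rate_level v0 r0.
  have sx : s < x by move: rx; rewrite ltNge sE -ltNge (gtr0_norm x0).
  exists ((s + x) / 2); split; [lra|lra|].
  by rewrite ltNge sE -ltNge gtr0_norm; lra.
have [r' /andP[]] := ereal_between ry; rewrite lte_fin => rr' r'y.
have xy0 : 0 < (x - y) / 2 by rewrite divr_gt0// subr_gt0.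
have rr0 : 0 < r' - r by rewrite subr_gt0.
near=> n.
have [A [mA ZA PA]] : exists A, [/\ measurable A,
     [set w | y <= `|Z n w|] `<=` A & (P A <= (expR (- (r' * b n ^+ 2)))%:E)%E].
  by near: n; exact: Zu.
have [B [mB DB PB]] : exists A, [/\ measurable A,
    [set w | (x - y) / 2 < `|D n w - Z n w|] `<=` A &
    (P A <= (expR (- (r' * b n ^+ 2)))%:E)%E] by near: n; exact: DZ.
have two : 2 * expR (- ((r' - r) * b n ^+ 2)) <= 1 by near: n; exact: mul_expR_le.
exists (A `|` B); split; first exact: measurableU.
  move=> w /= xD; have [yZ|Zy] := leP y `|Z n w|; [left; exact: ZA|right; apply: DB].
  rewrite /= (@lt_le_trans _ _ (x - y))//; first lra.
  rewrite (@le_trans _ _ (`|D n w| - `|Z n w|))// ?lerB ?(ltW Zy)//.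
  exact: lerB_dist.
apply: (le_trans (probability_setU_le mA mB PA PB)); rewrite lee_fin.
have -> : - (r' * b n ^+ 2) = - ((r' - r) * b n ^+ 2) + - (r * b n ^+ 2) by ring.
by rewrite expRD -mulrDl ler_piMl ?expR_ge0//; lra.
Unshelve. all: by end_near. Qed.

End exponential_equivalence.

(** * The autoregressive process at moderate deviation scale *)

(** Measurability is asked of [z 1], ..., [z n] only: this exact range yields predictability
    later. *)
Lemma measurable_ar d (T : measurableType d) (R : realType) (a : R)
    (z : nat -> T -> R) n :
  (forall k, (k < n)%N -> measurable_fun setT (z k.+1)) ->
  measurable_fun setT (fun w => ar a (fun k => z k w) n).
Proof.
elim: n => [|n IH] mz; first exact: measurable_cst.
apply: measurable_funD; last exact: mz.
by apply: measurable_funM => //; apply: IH => k kn; apply: mz; exact: ltnW.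
Qed.

Lemma measurable_centered_ar d (T : measurableType d) (R : realType)
    (theta rho : R) (z : nat -> T -> R) n :
  (forall k, (k < n)%N -> measurable_fun setT (z k.+1)) ->
  measurable_fun setT (fun w => centered_ar theta rho (fun k => z k w) n).
Proof.
move=> mz; apply: (@measurable_ar _ _ _ theta (fun k w => ar rho (fun j => z j w) k)).
by move=> k kn; apply: measurable_ar => j jk; apply: mz; exact: leq_trans kn.
Qed.

Section moderate_scale.
Context d (T : measurableType d) (R : realType) (P : probability T R).
Variable b : nat -> R.
Hypothesis b_gt0 : forall n, (0 < n)%N -> 0 < b n.
Hypothesis b_infty : b n @[n --> \oo] --> +oo.
Hypothesis b_sqrt : b n / Num.sqrt n%:R @[n --> \oo] --> 0.

(** The normalisation of M and N: (sqrt n / b_n) (M / n) = M / (b_n sqrt n). *)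
Definition scale n : R := b n * Num.sqrt n%:R.

Lemma scale_gt0 n : (0 < n)%N -> 0 < scale n.
Proof. by move=> n0; rewrite mulr_gt0 ?b_gt0// sqrtr_gt0 ltr0n. Qed.

Lemma b_sqrE n : (0 < n)%N -> b n ^+ 2 = b n / Num.sqrt n%:R * scale n.
Proof.
move=> n0; rewrite /scale; field.
by rewrite gt_eqF// sqrtr_gt0 ltr0n.
Qed.

Lemma near_gt0 : \forall n \near \oo, (0 < n)%N.
Proof. by near=> n; near: n; exact: nbhs_infty_gt. Unshelve. all: by end_near. Qed.

(** The quotient of b_n^2 by [scale n] is b_n / sqrt n, which tends to 0. *)
Lemma sqr_le_scale (c K : R) : 0 < c ->
  \forall n \near \oo, K * b n ^+ 2 <= c * scale n.
Proof.
move=> c0; have e0 : 0 < c / (`|K| + 1) by rewrite divr_gt0// ltr_wpDl.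
near=> n.
have n0 : (0 < n)%N by near: n; exact: near_gt0.
have s0 := scale_gt0 n0.
have u0 : 0 <= b n / Num.sqrt n%:R by rewrite divr_ge0 ?sqrtr_ge0// ltW// b_gt0.
have h : `|b n / Num.sqrt n%:R| <= c / (`|K| + 1).
  by near: n; apply: (cvgr0_norm_le _ b_sqrt).
rewrite (ger0_norm u0) ler_pdivlMr in h; last by rewrite ltr_wpDl.
rewrite b_sqrE// mulrA ler_wpM2r ?(ltW s0)//.
apply: le_trans h; rewrite mulrC ler_wpM2l//.
by rewrite (le_trans (ler_norm _))// lerDl.
Unshelve. all: by end_near. Qed.

Lemma scale_infty (C c : R) : 0 < c -> \forall n \near \oo, C <= c * scale n.
Proof.
move=> c0; near=> n.
have h : C * b n ^+ 2 <= c * scale n by near: n; exact: sqr_le_scale.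
have h' : 0 * b n ^+ 2 <= c * scale n by near: n; exact: sqr_le_scale.
rewrite mul0r in h'.
have b1 : 1 <= b n ^+ 2 by near: n; exact: b_sqr_infty.
have [C0|C0] := leP C 0; first exact: le_trans h'.
by apply: le_trans h; rewrite ler_peMr// ltW.
Unshelve. all: by end_near. Qed.

Lemma expR_scale_le (A c K : R) : 0 < c -> \forall n \near \oo,
  A * expR (- (c * scale n)) <= expR (- (K * b n ^+ 2)).
Proof.
move=> c0; have c20 : 0 < c / 2 by rewrite divr_gt0.
near=> n.
have h1 : A <= c / 2 * scale n by near: n; exact: scale_infty.
have h2 : K * b n ^+ 2 <= c / 2 * scale n by near: n; exact: sqr_le_scale.
have A1 : A <= expR (c / 2 * scale n).
  by rewrite (le_trans h1)// (le_trans _ (expR_ge1Dx _))// lerDr.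
rewrite (@le_trans _ _ (expR (- (c / 2 * scale n))))//; last by rewrite ler_expR lerN2.
rewrite (le_trans (ler_wpM2r (expR_ge0 _) A1))// -expRD ler_expR.
lra.
Unshelve. all: by end_near. Qed.

(** It pays for the union over the [n.+1] noise variables: c b_n eventually exceeds 2, and exp (2 u)
    >= (1 + u)^2 with u = sqrt n. *)
Lemma nat_le_expR_scale (c : R) : 0 < c ->
  \forall n \near \oo, n.+1%:R <= expR (c * scale n).
Proof.
move=> c0; near=> n.
have n0 : (0 < n)%N by near: n; exact: near_gt0.
have bc : 2 / c <= b n by near: n; apply: (cvgryPge _).1.
have s0 : 0 <= Num.sqrt (n%:R : R) by exact: sqrtr_ge0.
apply: (@le_trans _ _ (expR (2%:R * Num.sqrt n%:R))); last first.
  rewrite ler_expR /scale mulrA ler_wpM2r//.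
  by move: bc; rewrite ler_pdivrMr// mulrC.
rewrite expRM_natl.
apply: (@le_trans _ _ ((1 + Num.sqrt n%:R) ^+ 2)); last first.
  by rewrite lerXn2r ?nnegrE ?expR_ge0 ?expR_ge1Dx// addr_ge0.
by rewrite sqrrD expr1n sqr_sqrtr// mul1r -natr1; lra.
Unshelve. all: by end_near. Qed.

(** Markov's inequality gives a bound of order exp (- t e b_n sqrt n). This is how the assumption on
    the initial values is used. *)
Lemma rare_of_exponential_moment (Y : T -> R) (t : R) : measurable_fun setT Y ->
  0 < t -> (\int[P]_w (expR (t * Y w ^+ 2))%:E < +oo)%E ->
  forall e, 0 < e -> rare P b (fun n => [set w | e * scale n < Y w ^+ 2]).
Proof.
move=> mY t0 tY e e0 K.
have mf : measurable_fun setT (fun w => expR (t * Y w ^+ 2)).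
  by apply: measurableT_comp => //; apply: measurable_funM => //; exact: measurable_funX.
set m := (\int[P]_w _)%E in tY.
have mfin : m \is a fin_num.
  by rewrite ge0_fin_numE// integral_ge0// => w _; rewrite lee_fin expR_ge0.
have te : 0 < t * e by rewrite mulr_gt0.
near=> n; exists [set w | e * scale n <= Y w ^+ 2].
have mA : measurable [set w | e * scale n <= Y w ^+ 2].
  by apply: measurable_ge_set; exact: measurable_funX.
split => //; first by move=> w /ltW.
apply: (@le_trans _ _ (fine m / expR (t * e * scale n))%:E).
  apply: (@markov_bound _ _ _ P (fun w => expR (t * Y w ^+ 2))).
  - exact: mf.
  - by move=> w; exact: expR_ge0.
  - exact: mA.
  - exact: expR_gt0.
  - by move=> w /= h; rewrite ler_expR -mulrA ler_wpM2l// ltW.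
  - by rewrite fineK.
rewrite lee_fin -expRN.
by near: n; exact: expR_scale_le.
Unshelve. all: by end_near. Qed.



Section noise.
Variables (sigma : R) (W : nat -> {RV P >-> R}).
Hypothesis sigma0 : 0 < sigma.
Hypothesis Wind : mutually_independent W.
Hypothesis Wlaw : forall n, has_normal_law (W n) 0 sigma.

(* [W k] is the noise at time [k + 1]. *)
Definition noise_path (w : T) k : R := if k is j.+1 then W j w else 0.

Lemma rare_large_noise (e : R) : 0 < e ->
  rare P b (fun n => [set w | exists2 k, (k < n.+1)%N & e * scale n < W k w ^+ 2]).
Proof.
(* Half of the critical exponent 1 / (2 sigma^2), so that exp (c W^2) is integrable. *)
move=> e0 K; pose c := (4 * sigma ^+ 2)^-1.
have s20 : 0 < sigma ^+ 2 by rewrite exprn_gt0.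
have c0 : 0 < c by rewrite invr_gt0 mulr_gt0.
have cs : 2 * c * sigma ^+ 2 < 1.
  have -> : 2 * c * sigma ^+ 2 = 1 / 2 by rewrite /c; field; rewrite gt_eqF.
  by lra.
pose A0 := (Num.sqrt (1 - 2 * c * sigma ^+ 2))^-1.
have ce0 : 0 < c * e by rewrite mulr_gt0.
have ce20 : 0 < c * e / 2 by rewrite divr_gt0.
have A00 : 0 <= A0 by rewrite invr_ge0 sqrtr_ge0.
pose f n w := \sum_(k < n.+1) expR (c * W k w ^+ 2).
have mexp k : measurable_fun setT (fun w => expR (c * W k w ^+ 2)).
  by apply: measurableT_comp => //; apply: measurable_funM => //; exact: measurable_funX.
have mf n : measurable_fun setT (f n) by apply: measurable_sum.
have Ef n : (\int[P]_w (f n w)%:E = (n.+1%:R * A0)%:E)%E.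
  under eq_integral do rewrite -sumEFin.
  rewrite ge0_integral_sum//; last by move=> k; apply/measurable_EFinP.
  under eq_bigr do rewrite (expectation_expR_noise_sqr1 sigma0 Wind Wlaw)//.
  by rewrite -/A0 sumEFin sumr_const card_ord mulr_natl.
near=> n; exists [set w | expR (c * e * scale n) <= f n w].
have mA : measurable [set w | expR (c * e * scale n) <= f n w].
  exact: measurable_ge_set.
split => //.
  move=> w /= [k kn ekW]; rewrite /f (bigD1 (Ordinal kn))//=.
  rewrite (@le_trans _ _ (expR (c * W k w ^+ 2)))//.
    by rewrite ler_expR -mulrA ler_wpM2l// ltW.
  by rewrite lerDl sumr_ge0// => i _; exact: expR_ge0.
apply: (@le_trans _ _ ((n.+1%:R * A0) / expR (c * e * scale n))%:E).
  apply: (@markov_bound _ _ _ P (f n)) => //.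
  - by move=> w; rewrite sumr_ge0// => i _; exact: expR_ge0.
  - exact: expR_gt0.
  - by rewrite Ef.
rewrite lee_fin -expRN.
have h1 : n.+1%:R <= expR (c * e / 2 * scale n).
  by near: n; exact: nat_le_expR_scale.
have h2 : A0 * expR (- (c * e / 2 * scale n)) <= expR (- (K * b n ^+ 2)).
  by near: n; exact: expR_scale_le.
apply: le_trans h2; rewrite mulrAC mulrC ler_wpM2l//.
rewrite (le_trans (ler_wpM2r (expR_ge0 _) h1))// -expRD ler_expR.
lra.
Unshelve. all: by end_near. Qed.

Section autoregressive_process.
Variables (theta rho : R) (x e : nat -> T -> R).
Hypotheses (theta1 : `|theta| < 1) (rho1 : `|rho| < 1).
Hypothesis xE : forall k w, x k.+1 w = theta * x k w + e k.+1 w.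
Hypothesis eE : forall k w, e k.+1 w = rho * e k w + W k w.
Hypothesis x0_rare : forall r, 0 < r -> rare P b (fun n => [set w | r * scale n < x 0 w ^+ 2]).
Hypothesis e0_rare : forall r, 0 < r -> rare P b (fun n => [set w | r * scale n < e 0 w ^+ 2]).

Local Notation v := noise_path.

Let x_rec w k : x k.+1 w = theta * x k w + e k.+1 w. Proof. exact: xE. Qed.
Let e_rec w k : e k.+1 w = rho * e k w + v w k.+1. Proof. exact: eE. Qed.

(** Outside this event the initial values and the noise up to time n + 1 are at most sqrt (r scale
    n), and a product of two of them is at most r scale n. *)
Let large (r : R) n := [set w | r * scale n < x 0 w ^+ 2] `|`
  ([set w | r * scale n < e 0 w ^+ 2] `|`
   [set w | exists2 k, (k < n.+1)%N & r * scale n < W k w ^+ 2]).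

Let large_rare r : 0 < r -> rare P b (large r).
Proof.
move=> r0; apply: rare_setU => //; first exact: x0_rare.
by apply: rare_setU => //; [exact: e0_rare|exact: rare_large_noise].
Qed.

Let not_large r n w : 0 < r -> (0 < n)%N -> ~ large r n w ->
  let K := Num.sqrt (r * scale n) in
  [/\ `|x 0 w| <= K, `|e 0 w| <= K & forall k, (k < n.+1)%N -> `|v w k.+1| <= K].
Proof.
move=> r0 n0 /not_orP[hx /not_orP[he hW]] K.
have rs0 : 0 <= r * scale n by rewrite mulr_ge0// ltW// scale_gt0.
have sqr_le y : ~ (r * scale n < y ^+ 2) -> `|y| <= K.
  by move=> /negP; rewrite -leNgt -sqrtr_sqr => h; rewrite ler_wsqrtr.
split; [exact: sqr_le|exact: sqr_le|].
by move=> k kn; apply: sqr_le => h; apply: hW; exists k.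
Qed.

(** Both factors are at most sqrt (r scale n) times the gain of the filters. Indices reach [n.+1]
    because the boundary terms contain [x n.+1]. *)
Lemma edge_negligible (i j : nat -> nat) :
  (forall n, (i n <= n.+1)%N) -> (forall n, (j n <= n.+1)%N) ->
  negligible_seq P b (fun n w => x (i n) w * x (j n) w / scale n).
Proof.
move=> iE jE r r0; have g0 := ar_gain_gt0 theta1 rho1.
set g := ar_gain theta rho in g0.
have rg0 : 0 < r / g ^+ 2 by rewrite divr_gt0// exprn_gt0.
apply: rare_sub (large_rare rg0); near=> n => w /= h.
have n0 : (0 < n)%N by near: n; exact: near_gt0.
apply: contrapT => /(not_large rg0 n0)[hx he hW].
have s0 := scale_gt0 n0.
set K := Num.sqrt _ in hx he hW.
have K2 : K ^+ 2 = r / g ^+ 2 * scale n by rewrite sqr_sqrtr// mulr_ge0// ltW.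
have xK k : (k <= n.+1)%N -> `|x k w| <= K * g.
  exact: (autoregression_bound theta1 rho1 (x_rec w) (e_rec w) hx he hW).
move: h; rewrite ltNge => /negP; apply.
rewrite !normrM normfV (gtr0_norm s0) ler_pdivrMr//.
rewrite (le_trans (ler_pM _ _ (xK _ (iE n)) (xK _ (jE n))))//.
rewrite mulrACA -!expr2 K2 mulrAC divfK// gt_eqF// exprn_gt0//.
Unshelve. all: by end_near. Qed.

(** The largest noise times the l1 norm of the effect of the initial values, each of order sqrt (r
    scale n). The boolean selects the shift: 1 for M, 0 for N. *)
Lemma initial_values_negligible (i : bool) :
  negligible_seq P b (fun n w => (\sum_(k < n) W k.+1 w *
     (x (k + i)%N w - centered_ar theta rho (v w) (k + i)%N)) / scale n).
Proof.
move=> r r0.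
pose g := (1 + (1 - `|rho|)^-1) / (1 - `|theta|).
have t0 : 0 < 1 - `|theta| by rewrite subr_gt0.
have p0 : 0 < 1 - `|rho| by rewrite subr_gt0.
have g0 : 0 < g by rewrite divr_gt0// addr_gt0// invr_gt0.
have rg0 : 0 < r / g by rewrite divr_gt0.
apply: rare_sub (large_rare rg0); near=> n => w /= h.
have n0 : (0 < n)%N by near: n; exact: near_gt0.
apply: contrapT => /(not_large rg0 n0)[hx he hW].
have s0 := scale_gt0 n0.
set K := Num.sqrt _ in hx he hW.
have K0 : 0 <= K by exact: sqrtr_ge0.
have K2 : K ^+ 2 = r / g * scale n by rewrite sqr_sqrtr// mulr_ge0// ltW.
pose dx k := `|x k w - centered_ar theta rho (v w) k|.
have dx0 k : 0 <= dx k by exact: normr_ge0.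
have sum_dx : \sum_(k < n.+1) dx k <= K * g.
  have h1 := @initial_values_effect _ theta rho theta1 rho1 (fun k => x k w)
    (fun k => e k w) (v w) n.+1 (x_rec w) (e_rec w).
  apply: (le_trans h1).
  rewrite /g mulrA ler_pM2r ?invr_gt0// mulrDr mulr1 lerD// ler_pM2r// invr_gt0//.
have sum_m : \sum_(k < n) dx (k + i)%N <= K * g.
  apply: le_trans sum_dx; case: i h => _.
    rewrite [leRHS]big_ord_recl/= (eq_bigr (fun k : 'I_n => dx k.+1)) ?lerDr ?dx0// => k _.
    by rewrite addn1.
  rewrite [leRHS]big_ord_recr/= (eq_bigr (fun k : 'I_n => dx k)) ?lerDl ?dx0// => k _.
  by rewrite addn0.
move: h; rewrite ltNge => /negP; apply.
rewrite normrM normfV (gtr0_norm s0) ler_pdivrMr//.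
apply: (le_trans (ler_norm_sum _ _ _)).
apply: (@le_trans _ _ (\sum_(k < n) K * dx (k + i)%N)).
  apply: ler_sum => k _; rewrite normrM; apply: ler_wpM2r; first exact: dx0.
  by apply: (hW k.+1); rewrite ltnS.
rewrite -mulr_sumr (le_trans (ler_wpM2l K0 sum_m))//.
by rewrite mulrA -expr2 K2 mulrAC divfK// gt_eqF.
Unshelve. all: by end_near. Qed.

End autoregressive_process.
End noise.
End moderate_scale.

(** * Exponential moments of predictable linear forms *)

Section predictable_linear_form.
Context d (T : measurableType d) (R : realType) (P : probability T R).
Variable b : nat -> R.
Hypothesis b_gt0 : forall n, (0 < n)%N -> 0 < b n.
Hypothesis b_infty : b n @[n --> \oo] --> +oo.
Hypothesis b_sqrt : b n / Num.sqrt n%:R @[n --> \oo] --> 0.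
Variables (sigma : R) (W : nat -> {RV P >-> R}).
Hypothesis sigma0 : 0 < sigma.
Hypothesis Wind : mutually_independent W.
Hypothesis Wlaw : forall n, has_normal_law (W n) 0 sigma.
Variables (theta rho : R).
Hypotheses (theta1 : `|theta| < 1) (rho1 : `|rho| < 1).
Variables (c1 c2 : R).

Definition centered_process k w := centered_ar theta rho (noise_path W w) k.
(** [centered_process k.+1] involves [W 0], ..., [W k]; multiplied by [W k.+1] it gives a martingale
    increment. *)
Definition linear_form k w := c1 * centered_process k.+1 w + c2 * centered_process k w.
Definition noise_martingale n w := \sum_(k < n) W k.+1 w * linear_form k w.
Definition martingale_scaled n w := noise_martingale n w / scale b n.
Definition bracket_mean n w := sigma ^+ 2 * (\sum_(k < n) linear_form k w ^+ 2) / n%:R.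

(** The map [f] covers two uses: [T] with its own sigma-algebra, and the past, where [f] is the
    identity of the carrier. *)
Lemma measurable_centered_process d' (S : measurableType d') (f : S -> T) n :
  (forall k, (k < n)%N -> measurable_fun setT (W k \o f)) ->
  measurable_fun setT (centered_process n \o f).
Proof.
move=> mW.
apply: (@measurable_centered_ar _ _ _ theta rho (fun k w => noise_path W (f w) k)).
exact: mW.
Qed.

Lemma measurable_linear_form d' (S : measurableType d') (f : S -> T) n :
  (forall k, (k <= n)%N -> measurable_fun setT (W k \o f)) ->
  measurable_fun setT (linear_form n \o f).
Proof.
move=> mW; apply: measurable_funD; apply: measurable_funM => //.
  by apply: measurable_centered_process => k kn; exact: mW.
by apply: measurable_centered_process => k kn; apply: mW; exact: ltnW.
Qed.

Lemma measurable_martingale_scaled n : measurable_fun setT (martingale_scaled n).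
Proof.
apply: measurable_funM => //; apply: measurable_sum => k.
by apply: measurable_funM => //; exact: (@measurable_linear_form _ T id).
Qed.

Lemma measurable_bracket_mean n : measurable_fun setT (bracket_mean n).
Proof.
apply: measurable_funM => //; apply: measurable_funM => //.
apply: measurable_sum => k; apply: measurable_funX.
exact: (@measurable_linear_form _ T id).
Qed.

Lemma expectation_tilt l : \forall n \near \oo, (\int[P]_w
  (expR (b n ^+ 2 * (l * martingale_scaled n w - l ^+ 2 / 2 * bracket_mean n w)))%:E = 1)%E.
Proof.
near=> n; have n0 : (0 < n)%N by near: n; exact: near_gt0.
have nR : (n%:R : R) != 0 by rewrite pnatr_eq0 -lt0n.
have sn : Num.sqrt (n%:R : R) != 0 by rewrite gt_eqF// sqrtr_gt0 ltr0n.
have nE : n%:R = Num.sqrt (n%:R : R) ^+ 2 by rewrite sqr_sqrtr.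
have bn : b n != 0 by rewrite gt_eqF// b_gt0.
rewrite -[RHS](@exponential_martingale _ _ _ P sigma W sigma0 Wind Wlaw linear_form
  (l * (b n / Num.sqrt n%:R)) n).
  apply: eq_integral => w _; congr (expR _)%:E.
  rewrite /martingale_scaled /bracket_mean /noise_martingale /scale.
  by move: sn nE; set s := Num.sqrt _ => sn ->; field; rewrite bn sn.
move=> k m km; apply: (@measurable_linear_form _ _ (id : g_sigma_algebraType _ -> T)).
by move=> j jk; apply: measurable_noise_past; exact: leq_ltn_trans km.
Unshelve. all: by end_near. Qed.

Let energy_gain : R := 2 * (c1 ^+ 2 + c2 ^+ 2) /
  ((1 - `|rho|) ^+ 2 * (1 - `|theta|) ^+ 2).

Let energy_gain_ge0 : 0 <= energy_gain.
Proof.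
apply: divr_ge0; apply: mulr_ge0; rewrite ?sqr_ge0//.
by apply: addr_ge0; exact: sqr_ge0.
Qed.

(** The crude pathwise bound that yields exponential moments of the bracket before its limit is
    known. *)
Lemma sum_sqr_linear_form n w :
  \sum_(k < n) linear_form k w ^+ 2 <= energy_gain * \sum_(k < n.+2) W k w ^+ 2.
Proof.
have h := sum_sqr_centered_ar theta1 rho1 (noise_path W w) n.+1.
rewrite /= in h.
have h1 : \sum_(k < n) linear_form k w ^+ 2 <=
    2 * (c1 ^+ 2 + c2 ^+ 2) * \sum_(k < n.+1) centered_process k w ^+ 2.
  have i1 : \sum_(k < n) centered_process k.+1 w ^+ 2 <=
      \sum_(k < n.+1) centered_process k w ^+ 2.
    by rewrite [leRHS]big_ord_recl/= lerDr sqr_ge0.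
  have i2 : \sum_(k < n) centered_process k w ^+ 2 <=
      \sum_(k < n.+1) centered_process k w ^+ 2.
    by rewrite [leRHS]big_ord_recr/= lerDl sqr_ge0.
  have i3 : \sum_(k < n) linear_form k w ^+ 2 <=
      2 * c1 ^+ 2 * (\sum_(k < n) centered_process k.+1 w ^+ 2) +
      2 * c2 ^+ 2 * (\sum_(k < n) centered_process k w ^+ 2).
    rewrite 2!mulr_sumr -big_split/=; apply: ler_sum => k _; rewrite /linear_form.
    rewrite -subr_ge0; set p := centered_process _ _; set q := centered_process _ _.
    have -> : 2 * c1 ^+ 2 * p ^+ 2 + 2 * c2 ^+ 2 * q ^+ 2 - (c1 * p + c2 * q) ^+ 2 =
       (c1 * p - c2 * q) ^+ 2 by ring.
    exact: sqr_ge0.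
  have j1 := ler_wpM2l (sqr_ge0 c1) i1; have j2 := ler_wpM2l (sqr_ge0 c2) i2.
  lra.
apply: (le_trans h1); rewrite /energy_gain -[leRHS]mulrA; apply: ler_wpM2l.
  by apply: mulr_ge0 => //; apply: addr_ge0; exact: sqr_ge0.
by rewrite [leRHS]mulrC.
Qed.

(** 6 = 2 * 3: a factor 2 absorbs the quadratic term of [expectation_expR_noise_sqr_le], a factor 3
    the inequality n + 2 <= 3 n. *)
Let bracket_gain : R := 6 * sigma ^+ 4 * energy_gain.

Lemma bracket_gain_ge0 : 0 <= bracket_gain.
Proof. by rewrite mulr_ge0// mulr_ge0// exprn_ge0// ltW. Qed.

Lemma near_rate_sqr_le (C e : R) : 0 < e ->
  \forall n \near \oo, C * (b n / Num.sqrt n%:R) ^+ 2 <= e.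
Proof.
move=> e0; have C1 : 0 < `|C| + 1 by rewrite ltr_wpDl.
near=> n.
have u1 : `|b n / Num.sqrt n%:R| <= 1 by near: n; apply: (cvgr0_norm_le _ b_sqrt).
have ue : `|b n / Num.sqrt n%:R| <= e / (`|C| + 1).
  by near: n; apply: (cvgr0_norm_le _ b_sqrt); rewrite divr_gt0.
set u := b n / _ in u1 ue *.
have : u ^+ 2 <= e / (`|C| + 1).
  by rewrite -real_normK ?num_real// expr2 (le_trans _ ue)// ler_piMl.
rewrite ler_pdivlMr// => h; apply: le_trans h.
rewrite mulrC ler_wpM2l ?sqr_ge0// (le_trans (ler_norm _))// lerDl//.
Unshelve. all: by end_near. Qed.

Lemma expectation_bracket c : 0 <= c -> \forall n \near \oo,
  (\int[P]_w (expR (c * b n ^+ 2 * bracket_mean n w))%:E <=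
   (expR (bracket_gain * c * b n ^+ 2))%:E)%E.
Proof.
move=> c0; near=> n; have n0 : (0 < n)%N by near: n; exact: near_gt0.
have nR : 0 < (n%:R : R) by rewrite ltr0n.
have sn : Num.sqrt (n%:R : R) != 0 by rewrite gt_eqF// sqrtr_gt0.
have nE : n%:R = Num.sqrt (n%:R : R) ^+ 2 by rewrite sqr_sqrtr// ltW.
have s20 : 0 <= sigma ^+ 2 by exact: sqr_ge0.
(* The tilt transferred to the noise energy; it tends to 0 with b_n / sqrt n, hence enters the range
   of the moment bound. *)
pose c' := c * (b n / Num.sqrt n%:R) ^+ 2 * sigma ^+ 2 * energy_gain.
have c'0 : 0 <= c'.
  by rewrite mulr_ge0// mulr_ge0// mulr_ge0// sqr_ge0.
have c's : 2 * c' * sigma ^+ 2 <= 1 / 2.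
  have -> : 2 * c' * sigma ^+ 2 =
     2 * c * sigma ^+ 2 * energy_gain * sigma ^+ 2 * (b n / Num.sqrt n%:R) ^+ 2.
    by rewrite /c'; ring.
  by near: n; apply: near_rate_sqr_le; rewrite divr_gt0.
have c's0 : 0 <= c' * sigma ^+ 2 by rewrite mulr_ge0.
have mW2 : measurable_fun setT (fun w => \sum_(k < n.+2) W (k + 0)%N w ^+ 2).
  by apply: measurable_sum => k; exact: measurable_funX.
apply: (@le_trans _ _ (\int[P]_w (expR (c' * \sum_(k < n.+2) W (k + 0)%N w ^+ 2))%:E)%E).
  apply: ge0_expectation_le => [|||w].
  - apply: measurableT_comp => //; apply: measurable_funM => //.
    exact: measurable_bracket_mean.
  - by apply: measurableT_comp => //; exact: measurable_funM.
  - by move=> w; exact: expR_ge0.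
  - rewrite ler_expR; have h := sum_sqr_linear_form n w.
    have -> : c * b n ^+ 2 * bracket_mean n w =
      c * (b n / Num.sqrt n%:R) ^+ 2 * sigma ^+ 2 * \sum_(k < n) linear_form k w ^+ 2.
      rewrite /bracket_mean.
      by move: sn nE; set s := Num.sqrt _ => sn ->; field.
    rewrite /c' -[leRHS]mulrA; apply: ler_wpM2l.
      by rewrite mulr_ge0// mulr_ge0// sqr_ge0.
    apply: (le_trans h); rewrite le_eqVlt; apply/orP; left; apply/eqP.
    by congr (_ * _); apply: eq_bigr => k _; rewrite addn0.
apply: (le_trans (expectation_expR_noise_sqr_le sigma0 Wind Wlaw 0 n.+2 _)).
  by rewrite ger0_norm//; lra.
rewrite lee_fin ler_expR.
have -> : bracket_gain * c * b n ^+ 2 = 6 * (c' * sigma ^+ 2) * n%:R.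
  rewrite /bracket_gain /c'.
  by move: sn nE; set s := Num.sqrt _ => sn ->; field.
have h3 : c' * sigma ^+ 2 + (2 * c' * sigma ^+ 2) ^+ 2 <= 2 * (c' * sigma ^+ 2).
  have : (2 * c' * sigma ^+ 2) ^+ 2 <= (2 * c' * sigma ^+ 2) * (1 / 2).
    by rewrite expr2 ler_wpM2l//; lra.
  lra.
have n2 : (n.+2%:R : R) <= 3 * n%:R.
  have n1 : 1 <= (n%:R : R) by rewrite ler1n.
  by rewrite -addn2 natrD; lra.
have h0 : 0 <= c' * sigma ^+ 2 + (2 * c' * sigma ^+ 2) ^+ 2 by rewrite addr_ge0// sqr_ge0.
rewrite (le_trans (ler_pM h0 _ h3 n2))//; last lra.
Unshelve. all: by end_near. Qed.

Lemma martingale_scaled_tight : exp_tight P b martingale_scaled.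
Proof.
apply: (gaussian_tight b_infty measurable_martingale_scaled measurable_bracket_mean
  expectation_tilt expectation_bracket); exact: bracket_gain_ge0.
Qed.

End predictable_linear_form.

(** * Limits of the empirical second moments *)

Section limits.
Context d (T : measurableType d) (R : realType) (P : probability T R).
Variable b : nat -> R.
Hypothesis b_gt0 : forall n, (0 < n)%N -> 0 < b n.
Hypothesis b_infty : b n @[n --> \oo] --> +oo.
Hypothesis b_sqrt : b n / Num.sqrt n%:R @[n --> \oo] --> 0.
Variables (sigma : R) (W : nat -> {RV P >-> R}).
Hypothesis sigma0 : 0 < sigma.
Hypothesis Wind : mutually_independent W.
Hypothesis Wlaw : forall n, has_normal_law (W n) 0 sigma.

Local Notation negl := (negligible_seq P b).
Local Notation tight := (exp_tight P b).

(** For the tilt c = s b_n / sqrt n the centring cancels the linear term, and the quadratic one is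
    (2 c sigma^2)^2 n = 4 sigma^4 b_n^2. *)
Lemma noise_energy_tight :
  tight (fun n w => (\sum_(k < n) W k.+1 w ^+ 2 - n%:R * sigma ^+ 2) / scale b n).
Proof.
apply: (@tight_of_exponential_moments _ _ _ P b b_infty _ (4 * sigma ^+ 4)).
  move=> n; apply: measurable_funM => //; apply: measurable_funB => //.
  by apply: measurable_sum => k; exact: measurable_funX.
move=> s s1; have s2 : s ^+ 2 = 1 by rewrite -real_normK ?num_real// s1 expr1n.
near=> n; have n0 : (0 < n)%N by near: n; exact: near_gt0.
have sn : Num.sqrt (n%:R : R) != 0 by rewrite gt_eqF// sqrtr_gt0 ltr0n.
have nE : n%:R = Num.sqrt (n%:R : R) ^+ 2 by rewrite sqr_sqrtr.
have bn : b n != 0 by rewrite gt_eqF// b_gt0.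
have u0 : 0 <= b n / Num.sqrt n%:R by rewrite divr_ge0 ?sqrtr_ge0// ltW// b_gt0.
pose c := s * (b n / Num.sqrt n%:R).
have cs : `|2 * c * sigma ^+ 2| <= 1 / 2.
  have : `|b n / Num.sqrt n%:R| <= (4 * sigma ^+ 2)^-1.
    near: n; apply: (cvgr0_norm_le _ b_sqrt).
    by rewrite invr_gt0 mulr_gt0// exprn_gt0.
  rewrite (ger0_norm u0) -[leRHS]mul1r ler_pdivlMr; last by rewrite mulr_gt0// exprn_gt0.
  move=> h.
  have -> : 2 * c * sigma ^+ 2 = s * (b n / Num.sqrt n%:R * (2 * sigma ^+ 2)).
    by rewrite /c; ring.
  rewrite normrM s1 mul1r ger0_norm; first lra.
  by rewrite mulr_ge0// mulr_ge0// sqr_ge0.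
have mW2 : measurable_fun setT (fun w => expR (c * \sum_(k < n) W (k + 1)%N w ^+ 2)).
  apply: measurableT_comp => //; apply: measurable_funM => //.
  by apply: measurable_sum => k; exact: measurable_funX.
rewrite [leLHS](_ : _ = ((expR (- (c * n%:R * sigma ^+ 2)))%:E *
    \int[P]_w (expR (c * \sum_(k < n) W (k + 1)%N w ^+ 2))%:E)%E); last first.
  rewrite -ge0_integralZl//; last exact/measurable_EFinP.
  apply: eq_integral => w _; rewrite -EFinM -expRD; congr (expR _)%:E.
  have -> : \sum_(k < n) W (k + 1)%N w ^+ 2 = \sum_(k < n) W k.+1 w ^+ 2.
    by apply: eq_bigr => k _; rewrite addn1.
  by rewrite /c /scale; field; rewrite bn sn.
have h := expectation_expR_noise_sqr_le sigma0 Wind Wlaw 1 n cs.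
have e0 : (0 <= (expR (- (c * n%:R * sigma ^+ 2)))%:E)%E by rewrite lee_fin expR_ge0.
apply: (le_trans (lee_wpmul2l e0 h)).
rewrite -EFinM lee_fin -expRD ler_expR.
have -> : - (c * n%:R * sigma ^+ 2) + (c * sigma ^+ 2 + (2 * c * sigma ^+ 2) ^+ 2) * n%:R =
   4 * sigma ^+ 4 * (s ^+ 2 * ((b n / Num.sqrt n%:R) ^+ 2 * n%:R)).
  by rewrite /c; ring.
rewrite s2 mul1r le_eqVlt; apply/orP; left; apply/eqP; congr (_ * _).
by move: sn nE; set q := Num.sqrt _ => sn ->; field.
Unshelve. all: by end_near. Qed.

Lemma rate_negligible : negl (fun n _ => b n / Num.sqrt n%:R).
Proof. exact: negligible_cvg. Qed.

(* Passing from [f / scale] to [f / n] gains the factor [b n / sqrt n]. *)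
Lemma tight_mean f : tight (fun n w => f n w / scale b n) ->
  negl (fun n w => f n w / n%:R).
Proof.
move=> tf; apply: negligible_ext (negligibleM b_infty tf rate_negligible).
near=> n => w; have n0 : (0 < n)%N by near: n; exact: near_gt0.
have sn : Num.sqrt (n%:R : R) != 0 by rewrite gt_eqF// sqrtr_gt0 ltr0n.
have nE : n%:R = Num.sqrt (n%:R : R) ^+ 2 by rewrite sqr_sqrtr.
have bn : b n != 0 by rewrite gt_eqF// b_gt0.
by rewrite /scale; move: sn nE; set q := Num.sqrt _ => sn ->; field; rewrite bn sn.
Unshelve. all: by end_near. Qed.

Lemma noise_energy_mean :
  negl (fun n w => (\sum_(k < n) W k.+1 w ^+ 2) / n%:R - sigma ^+ 2).
Proof.
apply: negligible_ext (tight_mean noise_energy_tight).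
near=> n => w; have n0 : (0 < n)%N by near: n; exact: near_gt0.
by field; rewrite pnatr_eq0 -lt0n.
Unshelve. all: by end_near. Qed.

Section yule_walker_limits.
Variables (a c : R) (x : nat -> T -> R).
Hypothesis xE : forall k w, x k.+2 w = a * x k.+1 w + c * x k w + W k.+1 w.
Hypothesis edge : forall i j : nat -> nat,
  (forall n, (i n <= n.+1)%N) -> (forall n, (j n <= n.+1)%N) ->
  negl (fun n w => x (i n) w * x (j n) w / scale b n).
Hypothesis M_tight : tight (fun n w => (\sum_(k < n) W k.+1 w * x k.+1 w) / scale b n).
Hypothesis N_tight : tight (fun n w => (\sum_(k < n) W k.+1 w * x k w) / scale b n).
Hypothesis stationary : 0 < (1 + c) * ((1 - c) ^+ 2 - a ^+ 2).
Hypothesis c_lt1 : 0 < 1 - c.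

Let path w k := x k w.
Let v w k : R := if k is j.+1 then W j w else 0.
Let pathE w k : path w k.+2 = a * path w k.+1 + c * path w k + v w k.+2.
Proof. exact: xE. Qed.

Definition stationary_variance : R :=
  (1 - c) * sigma ^+ 2 / ((1 + c) * ((1 - c) ^+ 2 - a ^+ 2)).

Lemma edge1_negligible : negl (fun n w => edge1 a (path w) n / scale b n).
Proof.
have eij i j : (forall n, (i n <= n.+1)%N) -> (forall n, (j n <= n.+1)%N) ->
  negl (fun n w => path w (i n) * path w (j n) / scale b n) by exact: edge.
have h := negligibleD b_infty (negligibleB b_infty (negligibleZ b_infty a
  (negligibleB b_infty (eij id id (fun n => leqnSn n) (fun n => leqnSn n))
    (eij (fun=> 0%N) (fun=> 0%N) (fun=> isT) (fun=> isT))))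
  (eij succn id (fun n => leqnn n.+1) (fun n => leqnSn n)))
  (eij (fun=> 1%N) (fun=> 0%N) (fun=> isT) (fun=> isT)).
by apply: negligible_ext h; apply: nearW => n w; rewrite /edge1 /=; ring.
Qed.

Lemma edge2_negligible : negl (fun n w => edge2 a (path w) n / scale b n).
Proof.
have eij i j : (forall n, (i n <= n.+1)%N) -> (forall n, (j n <= n.+1)%N) ->
  negl (fun n w => path w (i n) * path w (j n) / scale b n) by exact: edge.
have e00 := eij (fun=> 0%N) (fun=> 0%N) (fun=> isT) (fun=> isT).
have e10 := eij (fun=> 1%N) (fun=> 0%N) (fun=> isT) (fun=> isT).
have e11 := eij (fun=> 1%N) (fun=> 1%N) (fun=> isT) (fun=> isT).
have enn := eij id id (fun n => leqnSn n) (fun n => leqnSn n).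
have emn := eij succn id (fun n => leqnn n.+1) (fun n => leqnSn n).
have emm := eij succn succn (fun n => leqnn n.+1) (fun n => leqnn n.+1).
have h := negligibleB b_infty (negligibleZ b_infty a (negligibleB b_infty emn e10))
  (negligibleD b_infty (negligibleB b_infty enn e00) (negligibleB b_infty emm e11)).
by apply: negligible_ext h; apply: nearW => n w; rewrite /edge2 /=; ring.
Qed.

(** After division by n, only the noise energy survives on the right of [variance_equation]. *)
Lemma energy_mean :
  negl (fun n w => (\sum_(k < n) x k w ^+ 2) / n%:R - stationary_variance).
Proof.
pose kp := (1 + c) * ((1 - c) ^+ 2 - a ^+ 2).
have kp0 : 0 < kp by exact: stationary.
have m1 := tight_mean M_tight; have m2 := tight_mean N_tight.
have m3 := noise_energy_mean.
have m4 := tight_mean (negligible_tight edge1_negligible).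
have m5 := tight_mean (negligible_tight edge2_negligible).
have h := negligibleZ b_infty kp^-1 (negligibleD b_infty
  (negligibleZ b_infty (a * (1 + c)) (negligibleD b_infty m1 m4))
  (negligibleZ b_infty (1 - c) (negligibleD b_infty (negligibleD b_infty
    (negligibleD b_infty (negligibleZ b_infty a m1) (negligibleZ b_infty (2 * c) m2)) m3) m5))).
apply: negligible_ext h; near=> n => w.
have n0 : (n%:R : R) != 0 by rewrite pnatr_eq0 -lt0n; near: n; exact: near_gt0.
have k0 : kp != 0 by rewrite gt_eqF.
have := variance_equation n (pathE w).
rewrite -/kp /v /path /= => e.
rewrite /stationary_variance -/kp; apply: (mulfI k0); apply: (mulfI n0).
set s0 := \sum_(k < n) x k w ^+ 2 in e *.
transitivity (kp * s0 - n%:R * ((1 - c) * sigma ^+ 2)); last by field; rewrite n0 k0.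
by rewrite e; field; rewrite n0 k0.
Unshelve. all: by end_near. Qed.

Lemma covariance_mean : negl (fun n w => (\sum_(k < n) x k.+1 w * x k w) / n%:R -
    a / (1 - c) * stationary_variance).
Proof.
have m1 := tight_mean M_tight.
have m4 := tight_mean (negligible_tight edge1_negligible).
have h := negligibleZ b_infty (1 - c)^-1 (negligibleD b_infty
  (negligibleZ b_infty a energy_mean) (negligibleD b_infty m1 m4)).
apply: negligible_ext h; near=> n => w.
have n0 : (n%:R : R) != 0 by rewrite pnatr_eq0 -lt0n; near: n; exact: near_gt0.
have c0 : 1 - c != 0 by rewrite gt_eqF.
have := yule_walker1 n (pathE w); rewrite /v /path /= => e.
apply: (mulfI c0); apply: (mulfI n0).
set s1 := \sum_(k < n) x k.+1 w * x k w in e *.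
transitivity ((1 - c) * s1 - n%:R * (a * stationary_variance)); last by field; rewrite n0 c0.
by rewrite e; field; rewrite n0 c0.
Unshelve. all: by end_near. Qed.

End yule_walker_limits.
End limits.

(** * Approximation of the Durbin-Watson statistic by a martingale *)

Section durbin_watson_approximation.
Context d (T : measurableType d) (R : realType) (P : probability T R).
Variable b : nat -> R.
Hypothesis b_gt0 : forall n, (0 < n)%N -> 0 < b n.
Hypothesis b_infty : b n @[n --> \oo] --> +oo.
Hypothesis b_sqrt : b n / Num.sqrt n%:R @[n --> \oo] --> 0.
Variables (sigma : R) (W : nat -> {RV P >-> R}).
Hypothesis sigma0 : 0 < sigma.
Hypothesis Wind : mutually_independent W.
Hypothesis Wlaw : forall n, has_normal_law (W n) 0 sigma.
Variables (theta rho : R).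
Hypotheses (theta1 : `|theta| < 1) (rho1 : `|rho| < 1).

Local Notation negl := (negligible_seq P b).
Local Notation tight := (exp_tight P b).
Local Notation a := (theta + rho).
Local Notation c := (- (theta * rho)).
Local Notation Xc := (centered_process W theta rho).
Local Notation ts := (a / (1 - c)).
Local Notation l0 := (stationary_variance sigma a c).

Let mul_lt1 : `|theta * rho| < 1.
Proof. by rewrite normrM mulr_ilt1. Qed.

Let c_lt1 : 0 < 1 - c.
Proof. by move: mul_lt1; rewrite ltr_norml => /andP[]; lra. Qed.

Let c_gtN1 : 0 < 1 + c.
Proof. by move: mul_lt1; rewrite ltr_norml => /andP[]; lra. Qed.

Let disc_gt0 : 0 < (1 - c) ^+ 2 - a ^+ 2.
Proof.
have -> : (1 - c) ^+ 2 - a ^+ 2 = (1 - theta ^+ 2) * (1 - rho ^+ 2) by ring.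
by rewrite mulr_gt0// subr_gt0 -real_normK ?num_real// expr_lt1.
Qed.

Let stationary : 0 < (1 + c) * ((1 - c) ^+ 2 - a ^+ 2).
Proof. exact: mulr_gt0. Qed.

Let l0_gt0 : 0 < l0.
Proof. by apply: divr_gt0 => //; apply: mulr_gt0 => //; exact: exprn_gt0. Qed.

Let ts_lt1 : 0 < 1 - ts ^+ 2.
Proof.
have -> : 1 - ts ^+ 2 = ((1 - c) ^+ 2 - a ^+ 2) / (1 - c) ^+ 2.
  by field; rewrite gt_eqF.
by apply: divr_gt0 => //; exact: exprn_gt0.
Qed.

(** The centered process is itself an instance of the model, with zero initial values. *)
Lemma centered_edge (i j : nat -> nat) :
  (forall n, (i n <= n.+1)%N) -> (forall n, (j n <= n.+1)%N) ->
  negl (fun n w => Xc (i n) w * Xc (j n) w / scale b n).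
Proof.
have zero_rare r : 0 < r -> rare P b (fun n => [set w : T | r * scale b n < (0 : R) ^+ 2]).
  move=> r0; apply: rare_sub (@rare0 _ _ _ P b); near=> n => w /=.
  have n0 : (0 < n)%N by near: n; exact: near_gt0.
  by rewrite expr0n/= ltNge mulr_ge0 ?(ltW r0)// ltW// scale_gt0.
move=> iE jE.
exact: (@edge_negligible _ _ _ _ b b_gt0 b_infty b_sqrt sigma W sigma0 Wind Wlaw theta rho
  Xc (fun k w => ar rho (noise_path W w) k) theta1 rho1).
Unshelve. all: by end_near. Qed.

Lemma centered_order2 k w : Xc k.+2 w = a * Xc k.+1 w + c * Xc k w + W k.+1 w.
Proof.
exact: (@autoregression_order2 _ theta rho (fun k => Xc k w)
  (fun k => ar rho (noise_path W w) k) (noise_path W w)).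
Qed.

Lemma martingale_scaledE c1 c2 n w : martingale_scaled b W theta rho c1 c2 n w =
  c1 * ((\sum_(k < n) W k.+1 w * Xc k.+1 w) / scale b n) +
  c2 * ((\sum_(k < n) W k.+1 w * Xc k w) / scale b n).
Proof.
rewrite /martingale_scaled /noise_martingale !mulrA -mulrDl; congr (_ / _).
rewrite 2!mulr_sumr -big_split/=; apply: eq_bigr => k _.
by rewrite /linear_form; ring.
Qed.

Lemma centered_M_tight : tight (fun n w => (\sum_(k < n) W k.+1 w * Xc k.+1 w) / scale b n).
Proof.
have := martingale_scaled_tight b_gt0 b_infty b_sqrt sigma0 Wind Wlaw theta1 rho1 1 0.
congr exp_tight; apply/funext => n; apply/funext => w.
by rewrite martingale_scaledE mul1r mul0r addr0.
Qed.

Lemma centered_N_tight : tight (fun n w => (\sum_(k < n) W k.+1 w * Xc k w) / scale b n).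
Proof.
have := martingale_scaled_tight b_gt0 b_infty b_sqrt sigma0 Wind Wlaw theta1 rho1 0 1.
congr exp_tight; apply/funext => n; apply/funext => w.
by rewrite martingale_scaledE mul1r mul0r add0r.
Qed.

(** sigma^2 times the stationary variance of c1 X_(k+1) + c2 X_k, where [ts] is the lag-one
    autocorrelation. *)
Definition limit_variance (c1 c2 : R) : R :=
  sigma ^+ 2 * (c1 ^+ 2 * l0 + 2 * c1 * c2 * (ts * l0) + c2 ^+ 2 * l0).

Lemma bracket_mean_limit c1 c2 :
  negl (fun n w => bracket_mean sigma W theta rho c1 c2 n w - limit_variance c1 c2).
Proof.
have e0 := energy_mean b_gt0 b_infty b_sqrt sigma0 Wind Wlaw centered_order2
  centered_edge centered_M_tight centered_N_tight stationary.
have e1 := covariance_mean b_gt0 b_infty b_sqrt sigma0 Wind Wlaw centered_order2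
  centered_edge centered_M_tight centered_N_tight stationary c_lt1.
have enn := tight_mean b_gt0 b_infty b_sqrt (negligible_tight
  (centered_edge (fun n => leqnSn n) (fun n => leqnSn n))).
have e00 := tight_mean b_gt0 b_infty b_sqrt (negligible_tight
  (@centered_edge (fun=> 0%N) (fun=> 0%N) (fun=> isT) (fun=> isT))).
have h := negligibleZ b_infty (sigma ^+ 2) (negligibleD b_infty
  (negligibleD b_infty (negligibleZ b_infty (c1 ^+ 2) (negligibleB b_infty
     (negligibleD b_infty e0 enn) e00))
     (negligibleZ b_infty (2 * c1 * c2) e1)) (negligibleZ b_infty (c2 ^+ 2) e0)).
apply: negligible_ext h; apply: nearW => n w.
rewrite /bracket_mean.
have -> : \sum_(k < n) linear_form W theta rho c1 c2 k w ^+ 2 =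
   c1 ^+ 2 * (\sum_(k < n) Xc k.+1 w ^+ 2) +
   2 * c1 * c2 * (\sum_(k < n) Xc k.+1 w * Xc k w) +
   c2 ^+ 2 * (\sum_(k < n) Xc k w ^+ 2).
  rewrite 3!mulr_sumr -!big_split/=; apply: eq_bigr => k _.
  by rewrite /linear_form; ring.
rewrite (sum_sqr_shift1 (fun k => Xc k w)) /limit_variance; ring.
Qed.

Definition residual_variance : R := l0 * (1 - ts ^+ 2).
(** The coefficients of [M] and [N] in [dw_expansion], with [theta_hat] replaced by its limit [ts]
    and the denominator over n by its limit. *)
Definition dw_coef1 : R :=
  2 * (c / (1 - c) * (1 - ts ^+ 2) - ts ^+ 2) * residual_variance^-1.
Definition dw_coef2 : R := 2 * ts * residual_variance^-1.

Lemma limit_varianceE c1 c2 : limit_variance c1 c2 =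
  sigma ^+ 2 * l0 * ((c1 + ts * c2) ^+ 2 + (1 - ts ^+ 2) * c2 ^+ 2).
Proof. by rewrite /limit_variance; ring. Qed.

Lemma limit_variance_ge0 c1 c2 : 0 <= limit_variance c1 c2.
Proof.
rewrite limit_varianceE; apply: mulr_ge0.
  by apply: mulr_ge0; [exact: sqr_ge0|exact: ltW].
by apply: addr_ge0; [exact: sqr_ge0|apply: mulr_ge0; [exact: ltW|exact: sqr_ge0]].
Qed.

(** As |ts| < 1 the quadratic form is definite. A zero variance thus makes the martingale
    identically zero, which settles the degenerate rate. *)
Lemma limit_variance_eq0 c1 c2 : limit_variance c1 c2 = 0 -> c1 = 0 /\ c2 = 0.
Proof.
rewrite limit_varianceE => /eqP; rewrite mulf_eq0 gt_eqF; last first.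
  by apply: mulr_gt0 => //; exact: exprn_gt0.
rewrite paddr_eq0 ?sqr_ge0//; last by apply: mulr_ge0; [exact: ltW|exact: sqr_ge0].
rewrite sqrf_eq0 mulf_eq0 (gt_eqF ts_lt1)/= sqrf_eq0 => /andP[/eqP h /eqP c20].
by move: h; rewrite c20 mulr0 addr0.
Qed.

Lemma limit_variance_dw : limit_variance dw_coef1 dw_coef2 = sigma2_D theta rho.
Proof.
have h1 : 1 + theta * rho != 0 by rewrite -[theta * rho]opprK gt_eqF.
have h2 : 1 - theta * rho != 0 by rewrite gt_eqF.
have h3 : (1 + theta * rho) ^+ 2 - a ^+ 2 != 0.
  by rewrite -[theta * rho]opprK gt_eqF.
have s1 : sigma != 0 by rewrite gt_eqF.
rewrite /limit_variance /dw_coef1 /dw_coef2 /residual_variance /stationary_variance.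
rewrite /sigma2_D /sigma2_rho.
(* Writing (1 - theta^2) (1 - rho^2) as (1 + theta rho)^2 - (theta + rho)^2 leaves a rational
   identity in the product and the sum of the parameters. *)
have -> : (1 - theta * rho) / (1 + theta * rho) ^+ 3 *
  (a ^+ 2 * (1 + theta * rho) ^+ 2 +
   (theta * rho) ^+ 2 * (1 - theta ^+ 2) * (1 - rho ^+ 2)) =
  (1 - theta * rho) / (1 + theta * rho) ^+ 3 *
  (a ^+ 2 * (1 + theta * rho) ^+ 2 +
   (theta * rho) ^+ 2 * ((1 + theta * rho) ^+ 2 - a ^+ 2)).
  by congr (_ * (_ + _)); ring.
rewrite opprK; move: h1 h2 h3; move: (theta * rho) => p; move: a => q h1 h2 h3.
by field; rewrite h1 h2 h3 s1.
Qed.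

Variables (X eps : nat -> T -> R).
Hypothesis XE : forall k w, X k.+1 w = theta * X k w + eps k.+1 w.
Hypothesis epsE : forall k w, eps k.+1 w = rho * eps k w + W k w.
Hypothesis X0_rare : forall r, 0 < r ->
  rare P b (fun n => [set w | r * scale b n < X 0 w ^+ 2]).
Hypothesis eps0_rare : forall r, 0 < r ->
  rare P b (fun n => [set w | r * scale b n < eps 0 w ^+ 2]).

Let edge := edge_negligible b_gt0 b_infty b_sqrt sigma0 Wind Wlaw theta1 rho1 XE epsE
  X0_rare eps0_rare.

Let X_order2 k w : X k.+2 w = a * X k.+1 w + c * X k w + W k.+1 w.
Proof.
exact: (@autoregression_order2 _ theta rho (fun k => X k w)
  (fun k => eps k w) (noise_path W w)).
Qed.

Local Notation M n w := ((\sum_(k < n) W k.+1 w * X k.+1 w) / scale b n).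
Local Notation N n w := ((\sum_(k < n) W k.+1 w * X k w) / scale b n).
Local Notation Mc n w := ((\sum_(k < n) W k.+1 w * Xc k.+1 w) / scale b n).
Local Notation Nc n w := ((\sum_(k < n) W k.+1 w * Xc k w) / scale b n).

Let M_centered : negl (fun n w => M n w - Mc n w).
Proof.
have := initial_values_negligible b_gt0 b_infty b_sqrt sigma0 Wind Wlaw theta1 rho1 XE epsE
  X0_rare eps0_rare true.
apply: negligible_ext; apply: nearW => n w; rewrite -mulrBl -sumrB; congr (_ / _).
by apply: eq_bigr => k _; rewrite addn1 mulrBr.
Qed.

Let N_centered : negl (fun n w => N n w - Nc n w).
Proof.
have := initial_values_negligible b_gt0 b_infty b_sqrt sigma0 Wind Wlaw theta1 rho1 XE epsE
  X0_rare eps0_rare false.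
apply: negligible_ext; apply: nearW => n w; rewrite -mulrBl -sumrB; congr (_ / _).
by apply: eq_bigr => k _; rewrite addn0 mulrBr.
Qed.

Let M_tight : tight (fun n w => M n w).
Proof.
have := tightD b_infty (negligible_tight M_centered) centered_M_tight.
by congr exp_tight; apply/funext => n; apply/funext => w; rewrite subrK.
Qed.

Let N_tight : tight (fun n w => N n w).
Proof.
have := tightD b_infty (negligible_tight N_centered) centered_N_tight.
by congr exp_tight; apply/funext => n; apply/funext => w; rewrite subrK.
Qed.

Let path w k := X k w.
Let t n w := theta_hat (path w) n.
Let den n w := dw_den (path w) n / n%:R.

Let energy : negl (fun n w => (\sum_(k < n) X k w ^+ 2) / n%:R - l0).
Proof.
exact: (energy_mean b_gt0 b_infty b_sqrt sigma0 Wind Wlaw X_order2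
  edge M_tight N_tight stationary).
Qed.

Lemma theta_hat_limit : negl (fun n w => t n w - ts).
Proof.
have cov := covariance_mean b_gt0 b_infty b_sqrt sigma0 Wind Wlaw X_order2
  edge M_tight N_tight stationary c_lt1.
have h := near_cstM b_infty cov (negligible_inv b_infty l0_gt0 energy).
apply: negligible_ext h; near=> n => w.
have n0 : (n%:R : R) != 0 by rewrite pnatr_eq0 -lt0n; near: n; exact: near_gt0.
rewrite mulfK ?gt_eqF// /t theta_hatE /path; congr (_ - _).
by rewrite invf_div mulrA divfK.
Unshelve. all: by end_near. Qed.

Let edge_nn := edge (fun n => leqnSn n) (fun n => leqnSn n).

Lemma dw_den_limit : negl (fun n w => den n w - l0 * (1 - ts ^+ 2)).
Proof.
have enn := tight_mean b_gt0 b_infty b_sqrt (negligible_tight edge_nn).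
have h := near_cstD b_infty (near_cstM b_infty energy (near_cstD b_infty
  (near_cst P b 1) (near_cstN (near_cstM b_infty theta_hat_limit theta_hat_limit))))
  (near_cst_negligible enn).
apply: negligible_ext h; apply: nearW => n w.
by rewrite /den dw_denE -/(t n w) /path; ring.
Qed.

Lemma dw_edge_negligible : negl (fun n w => dw_edge (path w) n / scale b n).
Proof.
have tt := tight_near_cst b_infty theta_hat_limit.
have t1 : tight (fun n w => 1 + t n w) by exact: (tightD b_infty (tight_cst P b 1) tt).
have t12 := tightM b_infty t1 t1.
have tt2 := tightM b_infty tt tt.
have t1t := tightM b_infty tt t1.
have le_0 n : (0 <= n.+1)%N by [].
have le_1 n : (1 <= n.+1)%N by [].
have le_n n : (n <= n.+1)%N by [].
have le_m n : (n.+1 <= n.+1)%N by [].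
have le_p n : (n.-1 <= n.+1)%N by rewrite (leq_trans (leq_pred n)).
have e00 := edge le_0 le_0; have e11 := edge le_1 le_1; have e10 := edge le_1 le_0.
have enn := edge le_n le_n; have emm := edge le_m le_m; have epp := edge le_p le_p.
have emn := edge le_m le_n; have emp := edge le_m le_p; have enp := edge le_n le_p.
have h := negligibleD b_infty (negligibleB b_infty (negligibleB b_infty
  (negligibleB b_infty enn e00) (negligibleM b_infty tt2 epp))
  (negligibleZ b_infty 2 (negligibleM b_infty tt emp)))
  (negligibleZ b_infty 2 (negligibleM b_infty t1t enp)).
apply: negligible_ext h; apply: nearW => n w.
by rewrite /dw_edge -/(t n w) /path /=; ring.
Qed.

Local Notation lJ := (residual_variance).
Local Notation coef_M := dw_coef1.
Local Notation coef_N := dw_coef2.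

Let lJ_gt0 : 0 < lJ. Proof. exact: mulr_gt0. Qed.

Let edge1_negl : negl (fun n w => edge1 a (path w) n / scale b n).
Proof. exact: edge1_negligible edge. Qed.

Let D_star_ac : D_star theta rho = 2 * (1 + c * ts).
Proof. by rewrite /D_star /rho_star /theta_star opprK; ring. Qed.

Theorem durbin_watson_martingale : negl (fun n w =>
  Num.sqrt n%:R / b n * (durbin_watson (path w) n - D_star theta rho) -
  martingale_scaled b W theta rho coef_M coef_N n w).
Proof.
have den_inv := negligible_inv b_infty lJ_gt0 dw_den_limit.
have den_tight := tight_near_cst b_infty den_inv.
have tl := theta_hat_limit.
have tt := near_cstM b_infty tl tl.
have one := near_cst P b 1.
have A_lim := near_cstM b_infty (near_cstM b_infty (near_cst P b 2)
  (near_cstD b_infty (near_cstM b_infty (near_cst P b (c / (1 - c)))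
    (near_cstD b_infty one (near_cstN tt))) (near_cstN tt))) den_inv.
have B_lim := near_cstM b_infty (near_cstM b_infty (near_cst P b 2) tl) den_inv.
have M'_tight := tightD b_infty M_tight (negligible_tight edge1_negl).
have M'_centered := negligibleD b_infty M_centered edge1_negl.
have r4 := negligibleB b_infty dw_edge_negligible (negligibleZ b_infty (D_star theta rho) edge_nn).
(* Each product is split into a tight sum times the error of its random coefficient, plus the limit
   coefficient times the error of centring; the last term gathers the boundary terms. *)
have h := negligibleD b_infty (negligibleD b_infty (negligibleD b_infty (negligibleD b_infty
  (negligibleM b_infty M'_tight A_lim) (negligibleZ b_infty coef_M M'_centered))
  (negligibleM b_infty N_tight B_lim)) (negligibleZ b_infty coef_N N_centered))
  (negligibleM b_infty den_tight r4).
pose G n w := (den n w)^-1 * (2 * (c / (1 - c) * (1 - t n w ^+ 2) *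
  (M n w + edge1 a (path w) n / scale b n) + t n w * (N n w - t n w *
  (M n w + edge1 a (path w) n / scale b n))) +
  (dw_edge (path w) n / scale b n - D_star theta rho * (X n w * X n w / scale b n))).
have {}h : negl (fun n w => G n w - martingale_scaled b W theta rho coef_M coef_N n w).
  apply: negligible_ext h; apply: nearW => n w.
  rewrite martingale_scaledE /G /coef_M /coef_N; set iJ := lJ^-1; set j := (den n w)^-1.
  rewrite /id; ring.
(* [G] is the expansion divided by the denominator. It may differ from the statistic where the
   denominator vanishes, a rare event since [den] has a positive limit. *)
apply: (negligible_rare b_infty _ h); apply: rare_sub (rare_near_cst_le lJ_gt0 dw_den_limit).
near=> n => w /= neq.
have n0 : (0 < n)%N by near: n; exact: near_gt0.
rewrite leNgt; apply/negP => den0; move: neq; apply/negP; rewrite negbK; apply/eqP.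
congr (_ - _).
have den_gt0 : 0 < den n w by rewrite (lt_trans _ den0)// divr_gt0.
have nR : 0 < (n%:R : R) by rewrite ltr0n.
have D0 : dw_den (path w) n != 0.
  by apply/eqP => D0; move: den_gt0; rewrite /den D0 mul0r ltxx.
have sn : Num.sqrt (n%:R : R) != 0 by rewrite gt_eqF// sqrtr_gt0.
have nE : n%:R = Num.sqrt (n%:R : R) ^+ 2 by rewrite sqr_sqrtr// ltW.
have bn : b n != 0 by rewrite gt_eqF// b_gt0.
have c0 : 1 - c != 0 by rewrite gt_eqF.
have := @dw_expansion R (path w) n a c (noise_path W w) n0 c0 (fun k => X_order2 k w).
rewrite -D_star_ac -/(t n w) /= => e.
have -> : durbin_watson (path w) n = dw_num (path w) n / dw_den (path w) n by [].
have -> : dw_num (path w) n / dw_den (path w) n - D_star theta rho =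
  (dw_num (path w) n - D_star theta rho * dw_den (path w) n) / dw_den (path w) n.
  by field.
rewrite e /G /den /scale /path.
move: sn nE; set q := Num.sqrt _ => sn ->.
by field; rewrite bn sn D0 c0.
Unshelve. all: by end_near. Qed.

End durbin_watson_approximation.

(** * Deviation bounds for the martingale, degenerate case included *)

Section martingale_bounds.
Context d (T : measurableType d) (R : realType) (P : probability T R).
Variable b : nat -> R.
Hypothesis b_gt0 : forall n, (0 < n)%N -> 0 < b n.
Hypothesis b_infty : b n @[n --> \oo] --> +oo.
Hypothesis b_sqrt : b n / Num.sqrt n%:R @[n --> \oo] --> 0.
Variables (sigma : R) (W : nat -> {RV P >-> R}).
Hypothesis sigma0 : 0 < sigma.
Hypothesis Wind : mutually_independent W.
Hypothesis Wlaw : forall n, has_normal_law (W n) 0 sigma.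
Variables (theta rho : R).
Hypotheses (theta1 : `|theta| < 1) (rho1 : `|rho| < 1).
Variables (c1 c2 : R).

Let Z := martingale_scaled b W theta rho c1 c2.
Let v := limit_variance sigma theta rho c1 c2.

Let v_ge0 : 0 <= v. Proof. exact: limit_variance_ge0. Qed.

Let Z_zero : v = 0 -> forall n w, Z n w = 0.
Proof.
move=> /(limit_variance_eq0 sigma0 theta1 rho1)[c10 c20] n w.
by rewrite /Z martingale_scaledE c10 c20 !mul0r addr0.
Qed.

Lemma martingale_lower (x r e : R) : (quadratic_rate v x < r%:E)%E -> 0 < e ->
  \forall n \near \oo, ((expR (- (r * b n ^+ 2)))%:E <=
     P [set w | (`|Z n w - x| < e)%R])%E.
Proof.
rewrite /quadratic_rate; have [v0|vn0] := eqVneq v 0.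
  case: eqP => // -> ; rewrite lte_fin => r0 e0; near=> n.
  rewrite (_ : [set w | _] = setT); last first.
    by apply/seteqP; split => // w _ /=; rewrite Z_zero// subrr normr0.
  rewrite probability_setT lee_fin -[leRHS]expR0 ler_expR oppr_le0.
  by rewrite mulr_ge0 ?sqr_ge0// ltW.
have v0 : 0 < v by rewrite lt_neqAle eq_sym vn0.
rewrite lte_fin => xr e0.
have rx : 0 < r - x ^+ 2 / (2 * v) by rewrite subr_gt0.
have := gaussian_lower b_infty
  (measurable_martingale_scaled b W theta rho c1 c2)
  (measurable_bracket_mean sigma W theta rho c1 c2)
  (expectation_tilt b_gt0 sigma0 Wind Wlaw theta rho c1 c2)
  (expectation_bracket b_sqrt sigma0 Wind Wlaw theta1 rho1 c1 c2)
  (bracket_gain_ge0 sigma0 theta rho c1 c2) v0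
  (bracket_mean_limit b_gt0 b_infty b_sqrt sigma0 Wind Wlaw theta1 rho1 c1 c2) x e0 rx.
by rewrite addrC subrK.
Unshelve. all: by end_near. Qed.

Lemma martingale_upper (x r : R) : 0 < x -> (r%:E < quadratic_rate v x)%E ->
  \forall n \near \oo, exists A, [/\ measurable A,
     [set w | x <= `|Z n w|] `<=` A & (P A <= (expR (- (r * b n ^+ 2)))%:E)%E].
Proof.
move=> x0; rewrite /quadratic_rate; have [v0|vn0] := eqVneq v 0.
  move=> _; apply: nearW => n; exists set0; split => //.
    by move=> w /=; rewrite Z_zero// normr0 leNgt x0.
  by rewrite measure0 lee_fin expR_ge0.
have v0 : 0 < v by rewrite lt_neqAle eq_sym vn0.
rewrite lte_fin => rx.
have xr : 0 < x ^+ 2 / (2 * v) - r by rewrite subr_gt0.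
have := gaussian_upper b_infty
  (measurable_martingale_scaled b W theta rho c1 c2)
  (measurable_bracket_mean sigma W theta rho c1 c2)
  (expectation_tilt b_gt0 sigma0 Wind Wlaw theta rho c1 c2) v0
  (bracket_mean_limit b_gt0 b_infty b_sqrt sigma0 Wind Wlaw theta1 rho1 c1 c2) x0 xr.
by rewrite subKr.
Qed.

End martingale_bounds.

Theorem theorem2p3 (d : measure_display) (T : measurableType d)
    (R : realType) (P : probability T R)
    (theta rho sigma : R) (X eps V : nat -> {RV P >-> R}) (b : nat -> R)
    (model : autoregressive_model theta rho sigma X eps V)
    (b_gt0 : forall n, (0 < n)%N -> 0 < b n)
    (b_incr : forall m n, (0 < m)%N -> (m <= n)%N -> b m <= b n)
    (b_infty : b n @[n --> \oo] --> +oo)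
    (b_sqrt : b n / Num.sqrt n%:R @[n --> \oo] --> 0)
    (gaussian : has_normal_law (V 1%N) 0 sigma)
    (moments : exists t : R, [/\ 0 < t,
      ('E_P[(fun w => expR (t * eps 0%N w ^+ 2))%R] < +oo)%E &
      ('E_P[(fun w => expR (t * X 0%N w ^+ 2))%R] < +oo)%E]) :
  large_deviation_principle
    (fun n => scaled_durbin_watson theta rho b X n : {RV P >-> R})
    (fun n => b n ^+ 2)
    (quadratic_rate (sigma2_D theta rho)).
Proof.
case: model => theta1 rho1 sigma0 Vind Vid _ _ _ _ XE epsE.
case: moments => t [t0 eps_moment X_moment].
(* The noise starts at time 1, so the shifted sequence carries the independence and the normal
   law. *)
pose W n := V n.+1.
have Wlaw n : has_normal_law (W n) 0 sigma.
  by move=> B mB; rewrite -(gaussian B mB); exact: Vid.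
have x0_rare := rare_of_exponential_moment (P := P) b_gt0 b_infty b_sqrt
  (measurable_funPT (X 0%N)) t0.
have e0_rare := rare_of_exponential_moment (P := P) b_gt0 b_infty b_sqrt
  (measurable_funPT (eps 0%N)) t0.
rewrite unlock in x0_rare e0_rare eps_moment X_moment.
have approx := durbin_watson_martingale b_gt0 b_infty b_sqrt sigma0 Vind Wlaw
  theta1 rho1 (X := X) (eps := eps) XE epsE (x0_rare X_moment) (e0_rare eps_moment).
set c1 := dw_coef1 sigma theta rho in approx; set c2 := dw_coef2 sigma theta rho in approx.
have vE : limit_variance sigma theta rho c1 c2 = sigma2_D theta rho.
  exact: limit_variance_dw.
have v0 : 0 <= sigma2_D theta rho by rewrite -vE limit_variance_ge0.
have mD n : measurable_fun setT (scaled_durbin_watson theta rho b X n).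
  exact: measurable_scaled_durbin_watson.
have mZ := measurable_martingale_scaled b W theta rho c1 c2.
apply: ldp_criterion => //.
- apply: (lower_bound_transfer b_infty mD mZ approx) => x r e.
  by rewrite -vE; exact: martingale_lower.
- apply: (upper_bound_transfer (D := scaled_durbin_watson theta rho b X) b_infty v0 approx) => x r.
  by rewrite -vE; exact: martingale_upper.
Qed.
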